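(* Let $(E,A)$ satisfy the standing assumptions below and set $p:=p_{\mathrm{res}}^{(E,A)}+1$. Then there exists a family of operators $(S_r(t))_{t\geq 0}$ on $X_{\operatorname{ran}} \coloneqq \overline{\operatorname{ran} R_r(\lambda)^{p}}$ and $\omega\in \mathbb R$, $C>0$ with $\Vert S_r(t)\Vert \leq C\mathrm{e}^{\omega t}$ and \[ R_r(\lambda)x_0 = \lambda^p \int_0^\infty \mathrm{e}^{-\lambda t} S_r(t)x_0 \,\mathrm{d}t \quad \text{for all } \lambda \in \rho(E,A)\cap \mathbb C_{\operatorname{Re} >\omega} \text{ and } x_0\in X_{\operatorname{ran}}. \]
   Context: Standing assumptions: $X$ and $Z$ are complex Banach spaces; $E\in L(X,Z)$ is bounded; $A\colon\mathrm{dom}(A)\subseteq X\to Z$ is closed and densely defined; $\rho(E,A)=\{\lambda\in\mathbb C : (\lambda E-A)^{-1}\in L(Z,X)\}$; the pair $(E,A)$ has a complex resolvent index, i.e.~there is a smallest $p_{\mathrm{res}}^{(E,A)}\in\mathbb N_0$ such that for some $\omega\in\mathbb R$, $C>0$ one has $\mathbb C_{\operatorname{Re}>\omega}\subseteq\rho(E,A)$ and $\Vert(\lambda E-A)^{-1}\Vert\le C|\lambda|^{p_{\mathrm{res}}^{(E,A)}-1}$ for all $\lambda\in\mathbb C_{\operatorname{Re}>\omega}$. Here $R_r(\lambda)\coloneqq(\lambda E-A)^{-1}E$ (right resolvent), $\operatorname{ran}$ denotes the range of an operator, and $\mathbb C_{\operatorname{Re}>\omega}=\{\lambda\in\mathbb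 C:\operatorname{Re}\lambda>\omega\}$. *)

(* Defs.v *)
From HB Require Import structures.
From mathcomp Require Import all_boot all_order all_algebra.
From mathcomp Require Import all_classical all_reals all_analysis.
From mathcomp Require Import complex.
Import Order.TTheory GRing.Theory Num.Theory.
Import numFieldNormedType.Exports.

Set Implicit Arguments.
Unset Strict Implicit.
Unset Printing Implicit Defensive.

Local Open Scope ring_scope.
Local Open Scope classical_set_scope.
Local Open Scope complex_scope.

(* Complex Banach spaces are modelled as [completeNormedModType R[i]] for a
   [R : realType]; R[i] is the field of complex numbers over R. *)

(* real-valued norm (the norm of a normedModType over R[i] is R[i]-valued
   with zero imaginary part) *)
Definition nrm (R : realType) (V : normedModType R[i]) (x : V) : R :=
  complex.Re `|x|.

Definition cexp (R : realType) (z : R[i]) : R[i] :=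
  (expR (complex.Re z))%:C * Complex (cos (complex.Im z)) (sin (complex.Im z)).

Definition op_bound (R : realType) (V W : normedModType R[i]) (T : V -> W)
  (M : R) : Prop := forall x, nrm (T x) <= M * nrm x.

Definition simple_eval (R : realType) (V : normedModType R[i]) (k : nat)
  (A : nat -> set R) (c : nat -> V) (t : R) : V :=
  \sum_(i < k) (if `[< A i t >] then c i else 0).

Definition simple_int (R : realType) (V : normedModType R[i]) (D : set R)
  (k : nat) (A : nat -> set R) (c : nat -> V) : V :=
  \sum_(i < k) (fine (@lebesgue_measure R (A i `&` D)))%:C *: c i.

Definition bochner_integral (R : realType) (V : normedModType R[i])
  (D : set R) (f : R -> V) (v : V) : Prop :=
  measurable D /\
  exists (g : R -> V) (k : nat -> nat) (A : nat -> nat -> set R)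
         (c : nat -> nat -> V),
    {ae @lebesgue_measure R, forall t, D t -> f t = g t} /\
    (forall n i, measurable (A n i) /\
                 (@lebesgue_measure R (A n i `&` D) < +oo)%E) /\
    (forall t, D t ->
       (fun n => simple_eval (k n) (A n) (c n) t) @ \oo --> g t) /\
    ((fun n => (\int[@lebesgue_measure R]_(t in D)
                  (nrm (g t - simple_eval (k n) (A n) (c n) t))%:E)%E)
       @ \oo --> 0%E) /\
    ((fun n => simple_int D (k n) (A n) (c n)) @ \oo --> v).

(* A : dom(A) ⊆ X -> Z is represented by its domain D and a function
   A : X -> Z whose values outside D are irrelevant. *)
Definition closed_densely_defined (R : realType)
  (X Z : normedModType R[i]) (D : set X) (A : X -> Z) : Prop :=
  [/\ D 0,
      (forall (a : R[i]) x y, D x -> D y -> D (a *: x + y)),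
      (forall (a : R[i]) x y, D x -> D y -> A (a *: x + y) = a *: A x + A y),
      closed [set xz : X * Z | D xz.1 /\ A xz.1 = xz.2]
    & closure D = setT].

Definition is_inverse_of (R : realType) (X Z : normedModType R[i])
  (E : X -> Z) (D : set X) (A : X -> Z) (lam : R[i]) (Rs : Z -> X) : Prop :=
  (forall z, D (Rs z) /\ lam *: E (Rs z) - A (Rs z) = z) /\
  (forall x, D x -> Rs (lam *: E x - A x) = x).

Definition in_rho (R : realType) (X Z : normedModType R[i])
  (E : X -> Z) (D : set X) (A : X -> Z) (lam : R[i]) : Prop :=
  exists Rs : {linear Z -> X},
    is_inverse_of E D A lam Rs /\ exists M : R, op_bound Rs M.

Definition res_estimate (R : realType) (X Z : normedModType R[i])
  (E : X -> Z) (D : set X) (A : X -> Z) (k : nat) : Prop :=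
  exists (omega C : R), 0 < C /\
    forall lam : R[i], omega < complex.Re lam ->
      exists Rs : {linear Z -> X}, is_inverse_of E D A lam Rs /\
        op_bound Rs (C * (complex.Re `|lam|) ^ (k%:Z - 1)).

Definition complex_resolvent_index (R : realType) (X Z : normedModType R[i])
  (E : X -> Z) (D : set X) (A : X -> Z) (pres : nat) : Prop :=
  res_estimate E D A pres /\
  (forall k, res_estimate E D A k -> (pres <= k)%N).

(* Main.v *)
(** With [R(l) = (l E - A)^-1 E], the resolvent estimate gives
    [F(l) = l^-p R(l) x = O(|l|^-2)] on a half-plane [Re l >= a], so the inverse
    Laplace integral [S(t) x = 1/(2 pi) * int e^(l t) F(l) d(Im l)] over the line
    [Re l = a] converges absolutely, for every [x] in [X], and is [O(e^(a t))];
    the subspace [Xran] enters only through its invariance under every [R(l)].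

    All vector-valued integrals are limits of Riemann sums with step [2^-n] over
    [[-n, n]].  Moving the line to the right by steps of length [2^-n] changes
    such a sum, by the Cauchy-Riemann equations in difference form, by a
    telescoping sum plus an error that vanishes in the limit; hence integrals of
    [O(|l|^-2)] holomorphic functions over the line vanish.  With the resolvent
    identity [R(l) = R(mu) + (mu - l) R(mu) R(l)] this yields
    [int F(l) / (mu - l) = 2 pi * mu^-p R(mu) x].  The constant [2 pi] is never
    identified: it is only needed that it is positive and independent of [mu].
    Finally the Riemann sums of [t |-> e^(-mu t) S(t) x] amount to replacing
    [1 / (mu - l)] by a geometric sum in [e^((l - mu) 2^-n)], which is
    [O(2^(-n/2) |l - mu|^(1/2))] close to it, and the step functions on the same
    grid are approximating simple functions for the Bochner integral. *)

Require Import Defs.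
From HB Require Import structures.
From mathcomp Require Import all_boot all_order all_algebra.
From mathcomp Require Import all_classical all_reals all_analysis.
From mathcomp Require Import complex.
From mathcomp Require Import zify ring lra.
Import Order.TTheory GRing.Theory Num.Theory.
Import numFieldNormedType.Exports.
Local Open Scope ring_scope.
Local Open Scope classical_set_scope.
Local Open Scope complex_scope.

(** * Real-valued norms, the complex modulus and the complex exponential *)

Definition cabs {R : realType} (z : R[i]) : R := complex.Re `|z|.

Section Norms.
Context {R : realType}.
Implicit Types (z w : R[i]) (V : normedModType R[i]).

Lemma normr_nrm V (x : V) : `|x| = (nrm x)%:C.
Proof. by rewrite /nrm RRe_real // normr_real. Qed.

Lemma normr_cabs z : `|z| = (cabs z)%:C.
Proof. by rewrite /cabs RRe_real // normr_real. Qed.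

Lemma nrm_ge0 V (x : V) : 0 <= nrm x.
Proof. by rewrite -ler0c -normr_nrm. Qed.

Lemma nrm0 V : nrm (0 : V) = 0.
Proof. by rewrite /nrm normr0. Qed.

Lemma nrmD V (x y : V) : nrm (x + y) <= nrm x + nrm y.
Proof. by rewrite -lecR rmorphD /= -!normr_nrm ler_normD. Qed.

Lemma nrmN V (x : V) : nrm (- x) = nrm x.
Proof. by rewrite /nrm normrN. Qed.

Lemma nrm_distC V (x y : V) : nrm (x - y) = nrm (y - x).
Proof. by rewrite /nrm distrC. Qed.

Lemma nrmB V (x y : V) : nrm (x - y) <= nrm x + nrm y.
Proof. by rewrite -(nrmN V y) nrmD. Qed.

Lemma nrmZ V z (x : V) : nrm (z *: x) = cabs z * nrm x.
Proof.
apply: (@complexI R); rewrite rmorphM /= -normr_nrm normrZ.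
by rewrite normr_nrm normr_cabs.
Qed.

Lemma nrm_sum V n (F : nat -> V) :
  nrm (\sum_(i < n) F i) <= \sum_(i < n) nrm (F i).
Proof.
elim: n => [|n IH]; first by rewrite !big_ord0 nrm0.
by rewrite !big_ord_recr /= (le_trans (nrmD _ _ _)) // lerD2r.
Qed.

Lemma cabs_ge0 z : 0 <= cabs z.
Proof. by rewrite -ler0c -normr_cabs. Qed.

Lemma cabsM z w : cabs (z * w) = cabs z * cabs w.
Proof.
by apply: (@complexI R); rewrite rmorphM /= -!normr_cabs normrM.
Qed.

Lemma cabsV z : cabs z^-1 = (cabs z)^-1.
Proof. by apply: (@complexI R); rewrite fmorphV /= -!normr_cabs normfV. Qed.

Lemma cabsX z n : cabs (z ^+ n) = cabs z ^+ n.
Proof. by apply: (@complexI R); rewrite rmorphXn /= -!normr_cabs normrX. Qed.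

Lemma cabsN z : cabs (- z) = cabs z.
Proof. by rewrite /cabs normrN. Qed.

Lemma cabsD z w : cabs (z + w) <= cabs z + cabs w.
Proof. by rewrite -lecR rmorphD /= -!normr_cabs ler_normD. Qed.

Lemma cabs0 : cabs (0 : R[i]) = 0.
Proof. by rewrite /cabs normr0. Qed.

Lemma cabs_eq0 z : (cabs z == 0) = (z == 0).
Proof.
by apply/eqP/eqP => [z0|->]; [apply/eqP; rewrite -normr_eq0 normr_cabs z0|exact: cabs0].
Qed.

Lemma cabsE z : cabs z = Num.sqrt (complex.Re z ^+ 2 + complex.Im z ^+ 2).
Proof. by rewrite /cabs normc_def. Qed.

Lemma cabs_real (x : R) : cabs x%:C = `|x|.
Proof. by rewrite cabsE /= expr0n addr0 sqrtr_sqr. Qed.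

Lemma cabs_ger0 (x : R) : 0 <= x -> cabs x%:C = x.
Proof. by move=> x0; rewrite cabs_real ger0_norm. Qed.

Lemma cabsi (x : R) : cabs (Complex 0 x) = `|x|.
Proof. by rewrite cabsE /= expr0n add0r sqrtr_sqr. Qed.

Lemma ler_normRe_cabs z : `|complex.Re z| <= cabs z.
Proof. by rewrite cabsE -sqrtr_sqr ler_wsqrtr // lerDl sqr_ge0. Qed.

Lemma ler_normIm_cabs z : `|complex.Im z| <= cabs z.
Proof. by rewrite cabsE -sqrtr_sqr ler_wsqrtr // lerDr sqr_ge0. Qed.

Lemma ler_Re_cabs z : complex.Re z <= cabs z.
Proof. by rewrite (le_trans (ler_norm _)) // ler_normRe_cabs. Qed.

Lemma ler_cabs z : cabs z <= `|complex.Re z| + `|complex.Im z|.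
Proof.
rewrite {1}[z]complexE (le_trans (cabsD _ _)) // cabsM cabs_real.
by rewrite -[X in cabs X * _]/(Complex 0 1) cabsi normr1 mul1r cabs_real.
Qed.

Lemma ReD z w : complex.Re (z + w) = complex.Re z + complex.Re w.
Proof. by case: z w => [a b] [c d]. Qed.

Lemma ReN z : complex.Re (- z) = - complex.Re z.
Proof. by case: z. Qed.

Lemma ImD z w : complex.Im (z + w) = complex.Im z + complex.Im w.
Proof. by case: z w => [a b] [c d]. Qed.

Lemma ReMr z (x : R) : complex.Re (z * x%:C) = complex.Re z * x.
Proof. by case: z => [a b]; rewrite -[_ * _]/(mulc _ _) /= mulr0 subr0. Qed.

Lemma Re_gt0_neq0 z : 0 < complex.Re z -> z != 0.
Proof. by apply: contraTneq => ->; rewrite ltxx. Qed.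

Lemma cexpE z : cexp z = Complex (expR (complex.Re z) * cos (complex.Im z))
                                 (expR (complex.Re z) * sin (complex.Im z)).
Proof.
rewrite /cexp -[_ * _]/(mulc _ _) /=.
by rewrite !mul0r subr0 addr0.
Qed.

Lemma cexpD z w : cexp (z + w) = cexp z * cexp w.
Proof.
rewrite /cexp ReD ImD expRD rmorphM /= cosD sinD.
set a := (expR _)%:C; set b := (expR _)%:C.
rewrite mulrACA; congr (_ * _); rewrite -[RHS]/(mulc _ _) /=.
by congr Complex; rewrite addrC.
Qed.

Lemma cexp0 : cexp (0 : R[i]) = 1.
Proof. by rewrite cexpE /= expR0 !mul1r cos0 sin0. Qed.

Lemma cabs_cexp z : cabs (cexp z) = expR (complex.Re z).
Proof.
rewrite cexpE cabsE /= !exprMn -mulrDr cos2Dsin2 mulr1.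
by rewrite sqrtr_sqr ger0_norm // expR_ge0.
Qed.

End Norms.

(** * Convergence expressed through real-valued norms *)

Section Convergence.
Context {R : realType}.
Implicit Types (V : normedModType R[i]).

Lemma cvg_nrmP V (f : nat -> V) (l : V) :
  f @ \oo --> l <-> (fun n => nrm (f n - l)) @ \oo --> (0 : R).
Proof.
split=> [/cvgrPdist_lt fl|/cvgrPdist_lt fl].
  apply/cvgrPdist_lt => e e0.
  have := fl e%:C; rewrite ltcR => /(_ e0); apply: filterS => n.
  by rewrite sub0r normrN normr_nrm ltcR nrm_distC ger0_norm ?nrm_ge0.
apply/cvgrPdist_lt => e e0.
(* Radii of balls in [V] are positive elements of [R[i]], hence real. *)
have ee : e = (complex.Re e)%:C by rewrite RRe_real // gtr0_real.
have e0' : 0 < complex.Re e by rewrite -ltcR -ee.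
have := fl _ e0'; apply: filterS => n.
by rewrite sub0r normrN normr_nrm ee ltcR nrm_distC ger0_norm ?nrm_ge0.
Qed.

Lemma nrm_squeeze V (f : nat -> V) (l : V) (e : nat -> R) :
  (forall n, nrm (f n - l) <= e n) -> e @ \oo --> (0 : R) -> f @ \oo --> l.
Proof.
move=> fe e0; apply/cvg_nrmP; apply: (squeeze_cvgr _ (cvg_cst 0) e0).
by apply: nearW => n; rewrite nrm_ge0 fe.
Qed.

Lemma cvg_nrm V (f : nat -> V) (l : V) :
  f @ \oo --> l -> (fun n => nrm (f n)) @ \oo --> nrm l.
Proof.
move=> /cvg_nrmP fl; apply/cvgrPdist_le => e e0.
have /cvgrPdist_le /(_ e e0) := fl; apply: filterS => n.
rewrite sub0r normrN ger0_norm ?nrm_ge0 // => h.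
have h1 := nrmD _ (f n - l) l; have h2 := nrmD _ (l - f n) (f n).
rewrite !subrK in h1 h2; rewrite (nrm_distC _ l) in h2.
rewrite ler_norml; apply/andP; split; lra.
Qed.

Lemma nrm_lim_le V (f : nat -> V) (l : V) (C : R) :
  f @ \oo --> l -> (forall n, nrm (f n) <= C) -> nrm l <= C.
Proof.
move=> /cvg_nrm fl fC; rewrite -(cvg_lim _ fl) //.
by apply: limr_le; [apply/cvg_ex; eexists; exact: fl|exact: nearW].
Qed.

Lemma cvg_bounded_op (V W : normedModType R[i]) (T : V -> W) (M : R)
    (f : nat -> V) (l : V) :
  (forall x y, T (x - y) = T x - T y) -> op_bound T M ->
  f @ \oo --> l -> (fun n => T (f n)) @ \oo --> T l.
Proof.
move=> TB TM /cvg_nrmP fl.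
apply: (@nrm_squeeze _ _ _ (fun n => M * nrm (f n - l))).
  by move=> n; rewrite -TB TM.
by rewrite -(mulr0 M); apply: cvgM => //; exact: cvg_cst.
Qed.

(** The increments add up to at most [g n - g (n + m)], so [f] is Cauchy. The telescoping majorant
    stands in for a summable series of increments. *)
Lemma cvg_telescope (V : completeNormedModType R[i]) (f : nat -> V)
    (g : nat -> R) :
  (forall n, nrm (f n.+1 - f n) <= g n - g n.+1) -> g @ \oo --> (0 : R) ->
  exists l : V, f @ \oo --> l.
Proof.
move=> fg g0.
have fgm n m : nrm (f (n + m)%N - f n) <= g n - g (n + m)%N.
  elim: m => [|m IH]; first by rewrite addn0 !subrr nrm0.
  have := nrmD _ (f (n + m).+1 - f (n + m)%N) (f (n + m)%N - f n).
  rewrite addrA subrK addnS; have := fg (n + m)%N; lra.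
suff h : cvgn f by exists (limn f).
apply: cauchy_cvg; apply: cauchy_exP => e e0.
have ee : e = (complex.Re e)%:C by rewrite RRe_real // gtr0_real.
have e0' : 0 < complex.Re e by rewrite -ltcR -ee.
have e2 : 0 < complex.Re e / 2 by rewrite divr_gt0.
have /cvgrPdist_lt /(_ _ e2) [N _ gN] := g0.
exists (f N); exists N => // n /= Nn.
rewrite -ball_normE /ball_ /= normr_nrm ee ltcR nrm_distC -(subnKC Nn).
apply: le_lt_trans (fgm _ _) _; rewrite subnKC //.
have := gN _ (leqnn N); have := gN _ Nn; rewrite /= !sub0r !normrN !ltr_norml.
by move=> /andP[? ?] /andP[? ?]; lra.
Qed.

(** Real sequences do not live in a normed space over [R[i]]; here monotone convergence applies
    instead, since [f - g] is nondecreasing and bounded above by [f 0 + g 0]. *)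
Lemma real_cvg_telescope (f g : nat -> R) :
  (forall n, `|f n.+1 - f n| <= g n - g n.+1) -> g @ \oo --> (0 : R) ->
  exists l : R, f @ \oo --> l.
Proof.
move=> fg g0.
have h : cvgn (fun n => f n - g n).
  apply: nondecreasing_is_cvgn.
    apply/nondecreasing_seqP => n; have := fg n; rewrite ler_norml => /andP[].
    by lra.
  have h n : f n + g n <= f 0%N + g 0%N.
    elim: n => // n IH; have := fg n; rewrite ler_norml => /andP[]; lra.
  have g_ge0 n : 0 <= g n.
    rewrite -(cvg_lim _ g0) //; apply: nonincreasing_cvgn_ge; last exact: cvgP g0.
    apply/nonincreasing_seqP => k; rewrite -subr_ge0.
    exact: le_trans (normr_ge0 _) (fg k).
  exists (f 0%N + g 0%N) => _ [n _ <-].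
  by have := g_ge0 n; have := h n; lra.
move/cvg_ex: h => [l hl]; exists (l + 0).
rewrite (_ : f = fun n => (f n - g n) + g n); last first.
  by apply/funext => n; rewrite subrK.
exact: (@cvgD R R^o _ _ _ (fun n => f n - g n) g _ _ hl g0).
Qed.

End Convergence.

Definition dyadic_mesh (R : realType) (n : nat) : R := (2 ^+ n)^-1.

(** The interval [[0, n]] and the mesh [2^-n] vary together, so an improper integral over the
    half-line is a single limit in [n]. *)
Definition rsum {R : realType} {V : normedModType R[i]} (n : nat) (G : R -> V) : V :=
  \sum_(k < n * 2 ^ n) (dyadic_mesh R n)%:C *: G (k%:R * dyadic_mesh R n).

(** Half of the tail integral of the weight [wt] below: [int_s^oo wt = 2 * isq s]. *)
Definition isq {R : realType} (s : R) : R := (Num.sqrt (1 + s))^-1.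

(* The exponent 3/2 rather than 2 leaves room for the factor [|l - mu|^(1/2)] of
   [time_kernel_approx]. *)
Definition wt {R : realType} (s : R) : R := ((1 + s) * Num.sqrt (1 + s))^-1.

Lemma big_ord_double {V : zmodType} (f : nat -> V) (K : nat) :
  \sum_(k < K.*2) f k = \sum_(k < K) (f k.*2 + f k.*2.+1).
Proof.
elim: K => [|K IH]; first by rewrite !big_ord0.
by rewrite doubleS !big_ord_recr /= IH addrA.
Qed.

Lemma big_ord_tail {V : zmodType} (f : nat -> V) (a b : nat) :
  \sum_(k < a + b) f k = \sum_(k < a) f k + \sum_(k < b) f (a + k)%N.
Proof.
by rewrite big_split_ord /=.
Qed.

(** * Riemann sums on dyadic grids *)

Section RiemannSums.
Context {R : realType}.
Implicit Types (V : normedModType R[i]) (s h : R).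
Local Notation mesh := (dyadic_mesh R).

Lemma mesh_gt0 n : 0 < mesh n.
Proof. by rewrite invr_gt0 exprn_gt0. Qed.

Lemma mesh_ge0 n : 0 <= mesh n.
Proof. exact: ltW (mesh_gt0 n). Qed.

Lemma mesh_le1 n : mesh n <= 1.
Proof. by rewrite invf_le1 ?exprn_gt0 // exprn_ege1 // ler1n. Qed.

Lemma exp2_mesh n : (2 ^ n)%:R * mesh n = 1 :> R.
Proof. by rewrite natrX divff // expf_neq0 // pnatr_eq0. Qed.

Lemma meshS n : mesh n = 2 * mesh n.+1.
Proof. by rewrite /dyadic_mesh exprS invfM mulrA divff ?mul1r // pnatr_eq0. Qed.

Lemma node_lt n k : (k < n * 2 ^ n)%N -> k%:R * mesh n < n%:R.
Proof.
move=> kn; have -> : n%:R = (n * 2 ^ n)%:R * mesh n.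
  by rewrite natrM -mulrA exp2_mesh mulr1.
by rewrite ltr_pM2r ?mesh_gt0 // ltr_nat.
Qed.

Lemma node_ge0 n k : 0 <= k%:R * mesh n.
Proof. by rewrite mulr_ge0 ?mesh_ge0. Qed.

(** Lets the mesh [2^-n] absorb polynomial growth on [[0, n]]. Induction on [m]: passing from [n] to
    [n + 1] raises the power [m + 1] by a multiple of the power [m], hence by a multiple of [2^n],
    and these increments add up to a multiple of [2^n]. *)
Lemma pow_le_exp2 m : exists C : R, 0 <= C /\ forall n, n.+1%:R ^+ m <= C * 2 ^+ n.
Proof.
have step k (x : R) : 1 <= x -> (x + 1) ^+ k.+1 <= x ^+ k.+1 + 3 ^+ k.+1 * x ^+ k.
  move=> x1; have x0 : 0 <= x by lra.
  elim: k => [|k IH]; first by rewrite !expr1 expr0; lra.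
  rewrite exprS; apply: le_trans (ler_wpM2l _ IH) _; first by lra.
  have p0 : 0 <= x ^+ k by exact: exprn_ge0.
  have p1 : x ^+ k <= x ^+ k.+1 by rewrite exprS ler_peMl.
  have q1 : 1 <= 3 ^+ k.+1 :> R by rewrite exprn_ege1 // ler1n.
  rewrite (exprS x k.+1) (exprS 3 k.+1).
  set a := x ^+ k.+1 in p1 *; set b := 3 ^+ k.+1 in q1 *.
  have xp : x * x ^+ k = a by rewrite /a exprS.
  have : 0 <= b * (a - x ^+ k) by rewrite mulr_ge0 //; lra.
  have : 0 <= (b - 1) * a by rewrite mulr_ge0 //; lra.
  have -> : (x + 1) * (a + b * x ^+ k) = x * a + a + b * a + b * x ^+ k.
    by rewrite -xp; ring.
  rewrite !(mulrBl, mulrBr) mul1r -!mulrA; lra.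
elim: m => [|m [C [C0 IH]]].
  exists 1; split => // n; rewrite expr0 mul1r exprn_ege1 // ler1n //.
have c0 : 0 <= 3 ^+ m.+1 * C by rewrite mulr_ge0 // exprn_ge0.
exists (1 + 3 ^+ m.+1 * C); split; first by lra.
elim=> [|n IHn]; first by rewrite expr1n expr0 mulr1; lra.
rewrite -natr1; apply: le_trans (step _ _ _) _; first by rewrite ler1n.
have h : 3 ^+ m.+1 * n.+1%:R ^+ m <= 3 ^+ m.+1 * (C * 2 ^+ n).
  by rewrite ler_wpM2l // exprn_ge0.
have := lerD IHn h; move/le_trans; apply.
have : 0 <= 2 ^+ n :> R by rewrite exprn_ge0.
rewrite (exprS 2 n); set a := 2 ^+ n; set b := 3 ^+ m.+1 => a0.
have -> : (1 + b * C) * (2 * a) = (1 + b * C) * a + b * (C * a) + a by ring.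
lra.
Qed.

Lemma isq_gt0 s : 0 <= s -> 0 < isq s.
Proof. by move=> s0; rewrite invr_gt0 sqrtr_gt0; lra. Qed.

Lemma wt_le s h : 0 <= s -> s <= h -> wt h <= wt s.
Proof.
move=> s0 sh; rewrite lef_pV2 ?posrE ?mulr_gt0 ?sqrtr_gt0 //; try lra.
by rewrite ler_pM ?sqrtr_ge0 ?ler_wsqrtr //; lra.
Qed.

Lemma wt0 : wt (0 : R) = 1.
Proof. by rewrite /wt addr0 sqrtr1 mulr1 invr1. Qed.

(** A decreasing function has its lower rectangle on [[s, s + h]] below its integral. Algebraically,
    with [a] and [b] the square roots of [1 + s] and [1 + s + h], the gap is
    [(b - a)^2 (2 b + a) / (a b^3)]. *)
Lemma wt_telescope s h : 0 <= s -> 0 <= h ->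
  h * wt (s + h) <= 2 * (isq s - isq (s + h)).
Proof.
move=> s0 h0; rewrite /wt /isq.
have x0 : 0 <= 1 + s by lra.
have y0 : 0 <= 1 + (s + h) by lra.
have ax := sqr_sqrtr x0; have bx := sqr_sqrtr y0.
have a0 : 0 < Num.sqrt (1 + s) by rewrite sqrtr_gt0; lra.
have b0 : 0 < Num.sqrt (1 + (s + h)) by rewrite sqrtr_gt0; lra.
have ab : Num.sqrt (1 + s) <= Num.sqrt (1 + (s + h)) by rewrite ler_wsqrtr //; lra.
move: ax bx a0 b0 ab.
set a := Num.sqrt (1 + s); set b := Num.sqrt (1 + (s + h)) => ax bx a0 b0 ab.
rewrite -bx (_ : h = b ^+ 2 - a ^+ 2); last by rewrite ax bx; ring.
rewrite -subr_ge0.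
have -> : 2 * (a^-1 - b^-1) - (b ^+ 2 - a ^+ 2) * (b ^+ 2 * b)^-1 =
  (b - a) * (b - a) * (2 * b + a) / (a * b ^+ 3).
  by field; rewrite !gt_eqF.
by rewrite !(mulr_ge0, invr_ge0, exprn_ge0) ?(ltW a0) ?(ltW b0) //; nra.
Qed.

(** The node [0] contributes [h <= 1]; the other nodes telescope to at most [2]. *)
Lemma sum_wt K h : 0 < h -> h <= 1 -> \sum_(k < K) h * wt (k%:R * h) <= 3.
Proof.
move=> h0 h1.
suff H n : \sum_(k < n.+1) h * wt (k%:R * h) <= h + 2 - 2 * isq (n%:R * h).
  case: K => [|n]; first by rewrite big_ord0; lra.
  by apply: le_trans (H n) _; have := @isq_gt0 (n%:R * h) (mulr_ge0 (ler0n _ _) (ltW h0)); lra.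
elim: n => [|n IH].
  by rewrite big_ord_recr big_ord0 /= mul0r wt0 /isq addr0 sqrtr1 invr1; lra.
rewrite big_ord_recr /=; have := @wt_telescope (n%:R * h) h.
have -> : n%:R * h + h = n.+1%:R * h by rewrite -natr1; ring.
by move=> /(_ (mulr_ge0 (ler0n _ _) (ltW h0)) (ltW h0)); lra.
Qed.

Lemma isq_cvg0 : (fun n => isq n%:R : R) @ \oo --> (0 : R).
Proof.
rewrite (_ : (fun n => _) = Num.sqrt \o harmonic); last first.
  by apply/funext => n /=; rewrite /isq /harmonic /= nat1r sqrtrV.
rewrite -[X in _ --> X](@sqrtr0 R).
by apply: (cvg_comp _ _ (@cvg_harmonic R)); exact: sqrt_continuous.
Qed.

Lemma mesh_cvg0 : (mesh : nat -> R) @ \oo --> (0 : R).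
Proof.
rewrite (_ : mesh = fun n => (1 / 2) ^+ n); last first.
  by apply/funext => n; rewrite /dyadic_mesh mul1r exprVn.
by apply: cvg_expr; rewrite ger0_norm //; lra.
Qed.

Lemma sqrt_mesh_cvg0 : (fun n => Num.sqrt (mesh n)) @ \oo --> (0 : R).
Proof.
rewrite -[X in _ --> X](@sqrtr0 R) -[fun n => Num.sqrt _]/(Num.sqrt \o mesh).
by apply: (cvg_comp _ _ mesh_cvg0); exact: sqrt_continuous.
Qed.

(** Since [wt] drops at most by the factor [4] between consecutive integers, the telescoping bound
    also holds at the left end point. It brings increments of size [wt n] into the form needed by
    [cvg_telescope]. *)
Lemma wt_telescope_nat n : wt n%:R <= 8 * isq n%:R - 8 * isq n.+1%:R :> R.
Proof.
have h := @wt_telescope n%:R 1 (ler0n _ _) ler01.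
rewrite mul1r natr1 in h.
suff : wt n%:R <= 4 * wt n.+1%:R :> R by lra.
rewrite /wt !nat1r -[4]invrK -invfM lef_pV2 ?posrE; last 2 first.
- by rewrite mulr_gt0 ?sqrtr_gt0 // ltr0n.
- by rewrite !mulr_gt0 ?invr_gt0 ?sqrtr_gt0 ?ltr0n.
have xy : n.+2%:R <= 2 * n.+1%:R :> R by rewrite -natrM ler_nat mul2n -addnn addSn addnS !ltnS leq_addr.
have sxy : Num.sqrt n.+2%:R <= 2 * Num.sqrt n.+1%:R :> R.
  rewrite -[2 in X in _ <= X]ger0_norm // -sqrtr_sqr -sqrtrM ?sqr_ge0 //.
  rewrite ler_wsqrtr // (le_trans xy) // ler_wpM2r //.
  by rewrite expr2; lra.
have := ler_pM (ler0n _ _) (sqrtr_ge0 _) xy sxy.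
rewrite ler_pdivrMl // => /le_trans; apply.
by rewrite mulrACA (_ : 2 * 2 = 4) //; ring.
Qed.

Lemma rsum_bound V (G : R -> V) (C : R) n :
  (forall s, 0 <= s -> nrm (G s) <= C * wt s) -> nrm (rsum n G) <= C * 3.
Proof.
move=> GC.
have C0 : 0 <= C by have := GC 0 (lexx _); rewrite wt0 mulr1; apply: le_trans (nrm_ge0 _ _).
apply: le_trans (nrm_sum _ _ (fun k => (mesh n)%:C *: G (k%:R * mesh n))) _.
apply: le_trans (ler_wpM2l C0 (sum_wt (n * 2 ^ n) (mesh n) (mesh_gt0 n) (mesh_le1 n))).
rewrite mulr_sumr; apply: ler_sum => k _.
rewrite nrmZ cabs_ger0 ?mesh_ge0 // mulrCA ler_wpM2l ?mesh_ge0 //.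
by apply: GC; exact: node_ge0.
Qed.

End RiemannSums.

Section RiemannSums2.
Context {R : realType}.
Implicit Types (V W : normedModType R[i]) (s h : R).
Local Notation mesh := (dyadic_mesh R).

Lemma rsumB V n (F G : R -> V) :
  rsum n (fun s => F s - G s) = rsum n F - rsum n G.
Proof. by rewrite /rsum -sumrB; apply: eq_bigr => k _; rewrite scalerBr. Qed.

Lemma rsumD V n (F G : R -> V) :
  rsum n (fun s => F s + G s) = rsum n F + rsum n G.
Proof. by rewrite /rsum -big_split; apply: eq_bigr => k _; rewrite scalerDr. Qed.

Lemma rsum_linear V W n (T : V -> W) (G : R -> V) :
  (forall a x y, T (a *: x + y) = a *: T x + T y) ->
  rsum n (fun s => T (G s)) = T (rsum n G).
Proof.
move=> Tl; have T0 : T 0 = 0.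
  by have := Tl (-1) 0 0; rewrite scaleN1r oppr0 addr0 scaleN1r addNr.
have TD x y : T (x + y) = T x + T y by rewrite -[x]scale1r Tl !scale1r.
have TZ a x : T (a *: x) = a *: T x by rewrite -[_ *: _]addr0 Tl T0 addr0.
rewrite /rsum; elim: (n * 2 ^ n)%N => [|K IH]; first by rewrite !big_ord0 T0.
by rewrite !big_ord_recr /= TD TZ IH.
Qed.

Lemma rsumZ V n (a : R[i]) (G : R -> V) :
  rsum n (fun s => a *: G s) = a *: rsum n G.
Proof.
by rewrite (rsum_linear V V n (fun x => a *: x)) // => b x y; rewrite scalerDr !scalerA mulrC.
Qed.

Lemma eq_rsum V n (F G : R -> V) :
  (forall s, 0 <= s -> F s = G s) -> rsum n F = rsum n G.
Proof. by move=> FG; apply: eq_bigr => k _; rewrite FG // node_ge0. Qed.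

(** Two changes occur from [n] to [n + 1]. The new interval [[n, n + 1]] costs [C * wt n]. Halving
    the cells of [[0, n]] costs one Lipschitz increment per cell, in total [2^-n] times a polynomial
    in [n], which is again [O(wt n)]. *)
Lemma rsum_refine V (G : R -> V) (C L : R) (m : nat) :
  (forall s, 0 <= s -> nrm (G s) <= C * wt s) ->
  (forall s t, 0 <= s -> s <= t -> nrm (G t - G s) <= L * (1 + t) ^+ m * (t - s)) ->
  exists C', 0 <= C' /\
    forall n, nrm (rsum n.+1 G - rsum n G) <= C' * wt n%:R.
Proof.
move=> GC GL.
have C0 : 0 <= C by have := GC 0 (lexx _); rewrite wt0 mulr1; apply: le_trans (nrm_ge0 _ _).
have L0 : 0 <= L.
  have := GL 0 1 (lexx _) ler01; rewrite subr0 mulr1 => /(le_trans (nrm_ge0 _ _)).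
  by rewrite pmulr_lge0 // exprn_gt0.
(* Of the exponent, [m] comes from the Lipschitz bound and one from the length [n] of the interval;
   the last two leave [(n + 1)^-2 <= wt n]. *)
have [D [D0 HD]] := pow_le_exp2 (R := R) (m + 3).
exists (C + L * D); split; first by rewrite addr_ge0 // mulr_ge0.
move=> n; rewrite /rsum.
set f := fun k => (mesh n.+1)%:C *: G (k%:R * mesh n.+1).
have -> : (n.+1 * 2 ^ n.+1 = (n * 2 ^ n).*2 + (2 ^ n).*2)%N.
  by rewrite expnS -!mul2n mulnCA (mulSn n) mulnDr addnC.
rewrite (big_ord_tail f) big_ord_double addrAC -sumrB.
rewrite mulrDl addrC (le_trans (nrmD _ _ _)) // lerD //.
  (* The [2^(n+1)] nodes from [n] on, each of weight [2^-(n+1)]. *)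
  apply: le_trans (nrm_sum _ _ (fun k => f ((n * 2 ^ n).*2 + k)%N)) _.
  apply: (@le_trans _ _ (\sum_(k < (2 ^ n).*2) mesh n.+1 * (C * wt n%:R))).
    apply: ler_sum => k _; rewrite nrmZ cabs_ger0 ?mesh_ge0 //.
    rewrite ler_wpM2l ?mesh_ge0 // (le_trans (GC _ (node_ge0 _ _))) //.
    rewrite ler_wpM2l // wt_le ?ler0n //.
    have -> : n%:R = (n * 2 ^ n).*2%:R * mesh n.+1.
      by rewrite -muln2 -mulnA mulnC -expnSr natrM mulrAC exp2_mesh mul1r.
    by rewrite ler_wpM2r ?mesh_ge0 // ler_nat leq_addr.
  by rewrite sumr_const card_ord -[_ *+ _]mulr_natl mulrA -muln2 -expnSr exp2_mesh mul1r.
(* In each old cell only the midpoint is new, so the error of the cell is [mesh n.+1] times an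
   increment of [G] over the distance [mesh n.+1]. *)
pose g k : V := (f k.*2 + f k.*2.+1) - (mesh n)%:C *: G (k%:R * mesh n).
apply: le_trans (nrm_sum _ _ g) _.
apply: (@le_trans _ _ (\sum_(k < n * 2 ^ n) mesh n * (L * n.+1%:R ^+ m * mesh n))).
  apply: ler_sum => k _; rewrite /g /f.
  set a := k%:R * mesh n.
  have -> : k.*2%:R * mesh n.+1 = a.
    by rewrite /a (meshS n) -mul2n natrM mulrCA mulrA.
  have -> : k.*2.+1%:R * mesh n.+1 = a + mesh n.+1.
    by rewrite /a (meshS n) -natr1 -mul2n natrM mulrDl mul1r mulrCA mulrA.
  rewrite (_ : (mesh n)%:C = (mesh n.+1)%:C + (mesh n.+1)%:C); last first.
    by rewrite -rmorphD /= (meshS n) -mulr2n mulr_natl.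
  rewrite scalerDl opprD addrACA subrr add0r -scalerBr nrmZ cabs_ger0 ?mesh_ge0 //.
  have m1 := mesh_ge0 (R := R) n.+1.
  have a0 : 0 <= a := node_ge0 _ _.
  have an : a + mesh n.+1 <= n%:R.
    rewrite /a (meshS n) mulrCA -[X in _ + X]mul1r mulrA -mulrDl.
    have -> : n%:R = (2 * (n * 2 ^ n)%:R) * mesh n.+1.
      by rewrite mulrAC -meshS mulrC natrM -mulrA exp2_mesh mulr1.
    rewrite ler_wpM2r // -!natrM natr1 ler_nat.
    by have := ltn_ord k; lia.
  have mm : mesh n.+1 <= mesh n by rewrite (meshS n); lra.
  apply: ler_pM; rewrite ?nrm_ge0 //.
  apply: le_trans (GL a (a + mesh n.+1) a0 _) _; first by lra.
  have p0 : 0 <= L * (1 + (a + mesh n.+1)) ^+ m by rewrite mulr_ge0 // exprn_ge0 //; lra.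
  have -> : a + mesh n.+1 - a = mesh n.+1 by ring.
  apply: ler_pM => //; rewrite ler_wpM2l // lerXn2r ?nnegrE ?ler0n //; first by lra.
  by rewrite -natr1; lra.
rewrite sumr_const card_ord -[_ *+ _]mulr_natr natrM.
have -> : mesh n * (L * n.+1%:R ^+ m * mesh n) * (n%:R * (2 ^ n)%:R) =
   L * (n.+1%:R ^+ m * n%:R * mesh n) * ((2 ^ n)%:R * mesh n) by ring.
rewrite exp2_mesh mulr1 -[X in _ <= X]mulrA ler_wpM2l //.
have n0 : 0 < n.+1%:R :> R by rewrite ltr0n.
apply: (@le_trans _ _ (D * (n.+1%:R ^+ 2)^-1)).
  rewrite ler_pdivlMr ?exprn_gt0 //.
  have -> : n.+1%:R ^+ m * n%:R * mesh n * n.+1%:R ^+ 2 = (n.+1%:R ^+ m * n.+1%:R ^+ 2 * n%:R) * mesh n by ring.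
  rewrite /dyadic_mesh ler_pdivrMr ?exprn_gt0 //.
  apply: le_trans (HD n); rewrite exprD mulrAC -!mulrA.
  rewrite ler_wpM2l ?exprn_ge0 // (exprS _ 2) ler_wpM2r ?exprn_ge0 ?ler_nat //.
rewrite ler_wpM2l // /wt nat1r lef_pV2 ?posrE ?exprn_gt0 ?mulr_gt0 ?sqrtr_gt0 //.
rewrite expr2 ler_wpM2l ?ler0n //.
rewrite -[X in _ <= X]ger0_norm ?ler0n // -sqrtr_sqr ler_wsqrtr //.
by rewrite expr2 ler_peMr ?ler0n // ler1n.
Qed.

Lemma rsum_cvg (V : completeNormedModType R[i]) (G : R -> V) (C L : R) (m : nat) :
  (forall s, 0 <= s -> nrm (G s) <= C * wt s) ->
  (forall s t, 0 <= s -> s <= t -> nrm (G t - G s) <= L * (1 + t) ^+ m * (t - s)) ->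
  exists l : V, (fun n => rsum n G) @ \oo --> l.
Proof.
move=> GC GL; have [C' [C0 H]] := rsum_refine V G C L m GC GL.
apply: (@cvg_telescope R V _ (fun n => C' * (8 * isq n%:R))).
  move=> n; apply: le_trans (H n) _; rewrite -mulrBr ler_wpM2l //.
  exact: wt_telescope_nat.
rewrite -(mulr0 C'); apply: cvgM; first exact: cvg_cst.
by rewrite -(mulr0 8); apply: cvgM; [exact: cvg_cst|exact: isq_cvg0].
Qed.

End RiemannSums2.

(** * Sums over vertical lines *)

(** The line is folded into two rays from [a], and integration is with respect to the imaginary
    part. The node [a] belongs to both rays, which makes the sums exactly symmetric under
    conjugation. *)
Definition lsum {R : realType} {V : normedModType R[i]} (n : nat)
    (F : R[i] -> V) (a : R) : V :=
  rsum n (fun s => F (Complex a s)) + rsum n (fun s => F (Complex a (- s))).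

Definition poly_bounded {R : realType} {V : normedModType R[i]} (a : R)
    (g : R[i] -> R[i] -> V) :=
  exists (M : R) (m : nat), 0 <= M /\ forall x y : R[i],
    a <= complex.Re x -> a <= complex.Re y ->
    nrm (g x y) <= M * ((1 + cabs x) * (1 + cabs y)) ^+ m.

(* Quantitative holomorphy on [Re >= a]: a second-order Taylor expansion with
   polynomially growing coefficients and remainder. *)
Definition smooth {R : realType} {V : normedModType R[i]} (a : R)
    (F : R[i] -> V) :=
  exists (F1 : R[i] -> V) (F2 : R[i] -> R[i] -> V),
    [/\ poly_bounded a (fun x _ => F x), poly_bounded a (fun x _ => F1 x),
        poly_bounded a F2
      & forall x y : R[i], a <= complex.Re x -> a <= complex.Re y ->
          F y = F x + (y - x) *: F1 x + (y - x) ^+ 2 *: F2 x y].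

(** Product rule for second-order expansions. The coefficient of [d] is Leibniz's; all terms of
    higher order go into the remainder, in which the value of the second factor at the end point is
    kept whole. *)
Lemma taylor_scale (K : comNzRingType) (V : lmodType K) (f f1 f2 d : K) (g g1 g2 : V) :
  f *: g + d *: (f *: g1 + f1 *: g) +
    d ^+ 2 *: (f1 *: g1 + (f + d * f1) *: g2 + f2 *: (g + d *: g1 + d ^+ 2 *: g2)) =
  (f + d * f1 + d ^+ 2 * f2) *: (g + d *: g1 + d ^+ 2 *: g2).
Proof.
rewrite !(scalerDl, scalerDr) !scalerA.
(* Nine monomials stand on each side; the pattern groups those of the left by the factors [f],
   [d * f1], [d^2 * f2] of the right. *)
rewrite [LHS](AC (1*2*((1*2)*3)) ((1*2*5)*(3*4*6)*(7*8*9)))/=.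
by repeat congr (_ + _); congr (_ *: _); ring.
Qed.

(** * Functions with second-order expansions: products and resolvents *)

Section Smooth.
Context {R : realType}.
Implicit Types (V W : normedModType R[i]) (a s h : R).

Lemma one_le_weight (x y : R[i]) : 1 <= (1 + cabs x) * (1 + cabs y).
Proof. by rewrite mulr_ege1 // lerDl cabs_ge0. Qed.

Lemma poly_boundedW V a (g : R[i] -> R[i] -> V) M m M' m' :
  0 <= M -> M <= M' -> (m <= m')%N ->
  (forall x y : R[i], a <= complex.Re x -> a <= complex.Re y ->
    nrm (g x y) <= M * ((1 + cabs x) * (1 + cabs y)) ^+ m) ->
  (forall x y : R[i], a <= complex.Re x -> a <= complex.Re y ->
    nrm (g x y) <= M' * ((1 + cabs x) * (1 + cabs y)) ^+ m').
Proof.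
move=> M0 MM mm H x y xa ya; apply: le_trans (H x y xa ya) _.
have w1 := one_le_weight x y.
apply: ler_pM => //; first by rewrite exprn_ge0 // (le_trans ler01).
by rewrite ler_weXn2l.
Qed.

Lemma poly_boundedD V a (f g : R[i] -> R[i] -> V) :
  poly_bounded a f -> poly_bounded a g -> poly_bounded a (fun x y => f x y + g x y).
Proof.
move=> [M [m [M0 Hf]]] [N [k [N0 Hg]]].
exists (M + N), (maxn m k); split; first exact: addr_ge0.
move=> x y xa ya; rewrite mulrDl; apply: le_trans (nrmD _ _ _) _; apply: lerD.
  exact: (poly_boundedW _ a f M m M (maxn m k) M0 (lexx _) (leq_maxl _ _) Hf).
exact: (poly_boundedW _ a g N k N (maxn m k) N0 (lexx _) (leq_maxr _ _) Hg).
Qed.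

Lemma poly_boundedZ V a (f : R[i] -> R[i] -> R[i]^o) (g : R[i] -> R[i] -> V) :
  poly_bounded a f -> poly_bounded a g -> poly_bounded a (fun x y => f x y *: g x y).
Proof.
move=> [M [m [M0 Hf]]] [N [k [N0 Hg]]].
exists (M * N), (m + k)%N; split; first exact: mulr_ge0.
move=> x y xa ya; rewrite nrmZ exprD mulrACA.
by apply: ler_pM; rewrite ?nrm_ge0 ?cabs_ge0 //; [exact: Hf|exact: Hg].
Qed.

Lemma poly_bounded_swap V a (g : R[i] -> V) :
  poly_bounded a (fun x _ => g x) -> poly_bounded a (fun _ y => g y).
Proof.
move=> [M [m [M0 H]]]; exists M, m; split => // x y xa ya.
by rewrite mulrC -/(_ * _) mulrC [X in _ * X ^+ _]mulrC; exact: H.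
Qed.

Lemma poly_bounded_sub a : poly_bounded a (fun x y => y - x : R[i]^o).
Proof.
exists 1, 1%N; split => // x y _ _; rewrite mul1r expr1.
rewrite -/(cabs (y - x)) (le_trans (cabsD _ _)) // cabsN.
by have := mulr_ge0 (cabs_ge0 x) (cabs_ge0 y); rewrite mulrDl mul1r mulrDr mulr1; lra.
Qed.

Lemma smoothZ V a (f : R[i] -> R[i]^o) (G : R[i] -> V) :
  smooth a f -> smooth a G -> smooth a (fun x => f x *: G x).
Proof.
move=> [f1 [f2 [bf bf1 bf2 Hf]]] [G1 [G2 [bG bG1 bG2 HG]]].
exists (fun x => f x *: G1 x + f1 x *: G x).
exists (fun x y => f1 x *: G1 x + (f x + (y - x) *: f1 x : R[i]^o) *: G2 x y + f2 x y *: G y).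
split.
- exact: poly_boundedZ.
- by apply: poly_boundedD; exact: poly_boundedZ.
- apply: poly_boundedD; last by apply: poly_boundedZ => //; exact: poly_bounded_swap.
  apply: poly_boundedD; first exact: poly_boundedZ.
  apply: poly_boundedZ => //; apply: poly_boundedD => //.
  by apply: poly_boundedZ => //; exact: poly_bounded_sub.
move=> x y xa ya; apply/esym.
rewrite [X in _ = X *: _](Hf x y) // (HG x y xa ya).
exact: (taylor_scale R[i] V (f x) (f1 x) (f2 x y)).
Qed.

(** Inserting the resolvent identity into itself gives [T y v = T x v - (y - x) T x (T x v) + (y -
    x)^2 T x (T x (T y v))], which is the required expansion. *)
Lemma smooth_resolvent V a (T : R[i] -> V -> V) (M : R) (m : nat) (v : V) :
  0 <= M ->
  (forall x, a <= complex.Re x -> forall u, nrm (T x u) <= M * (1 + cabs x) ^+ m * nrm u) ->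
  (forall x c u w, a <= complex.Re x -> T x (c *: u + w) = c *: T x u + T x w) ->
  (forall x y u, a <= complex.Re x -> a <= complex.Re y ->
    T y u = T x u - (y - x) *: T x (T y u)) ->
  smooth a (fun x => T x v).
Proof.
move=> M0 TM Tl Tres.
have w_ge0 (x : R[i]) : 0 <= 1 + cabs x by rewrite addr_ge0 ?cabs_ge0.
have Tp (g : R[i] -> R[i] -> V) : poly_bounded a g -> poly_bounded a (fun x y => T x (g x y)).
  move=> [N [k [N0 H]]]; exists (M * N), (m + k)%N; split; first exact: mulr_ge0.
  move=> x y xa ya; apply: le_trans (TM x xa _) _.
  rewrite exprD mulrACA; apply: ler_pM; rewrite ?nrm_ge0 ?H //.
    by rewrite mulr_ge0 ?exprn_ge0.
  rewrite ler_wpM2l // lerXn2r ?nnegrE ?mulr_ge0 //.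
  by rewrite ler_peMr // lerDl cabs_ge0.
have Tv : poly_bounded a (fun x _ => T x v).
  apply: Tp; exists (nrm v), 0%N; split; first exact: nrm_ge0.
  by move=> x y _ _; rewrite expr0 mulr1.
exists (fun x => - T x (T x v)), (fun x y => T x (T x (T y v))); split => //.
- have [N [k [N0 H]]] := Tp _ Tv.
  by exists N, k; split => // x y xa ya; rewrite nrmN H.
- exact/Tp/Tp/poly_bounded_swap.
move=> x y xa ya.
have E : T x (T y v) = T x (T x v) - (y - x) *: T x (T x (T y v)).
  by rewrite {1}(Tres x y) // addrC -scaleNr Tl // scaleNr addrC.
by rewrite {1}(Tres x y) // {1}E scalerBr opprB scalerA -expr2 scalerN -addrA [X in _ + X]addrC.
Qed.

(** Multiplication by [(x + d)^-1] satisfies the resolvent identity, and it is a contraction because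
    [Re (x + d) >= 1]. *)
Lemma smooth_inv a (d : R[i]) : 1 - a <= complex.Re d ->
  smooth a (fun x => (x + d)^-1 : R[i]^o).
Proof.
move=> ad.
have xd1 (x : R[i]) : a <= complex.Re x -> 1 <= complex.Re (x + d) by rewrite ReD; lra.
have xd0 (x : R[i]) : a <= complex.Re x -> x + d != 0.
  by move=> /xd1 h; apply: Re_gt0_neq0; lra.
have -> : (fun x => (x + d)^-1 : R[i]^o) = (fun x => (fun x u => (x + d)^-1 * u) x 1).
  by apply/funext => x; rewrite mulr1.
apply: (smooth_resolvent R[i]^o a (fun x u => (x + d)^-1 * u) 1 0 1 ler01).
- move=> x /xd1 h u; rewrite expr0 !mul1r -[nrm _]/(cabs ((x + d)^-1 * u)) -[nrm u]/(cabs u).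
  have h1 := ler_Re_cabs (x + d).
  rewrite cabsM cabsV ler_piMl ?cabs_ge0 // invf_le1; lra.
- by move=> x c u w _; rewrite mulrDr; congr (_ + _); exact: mulrCA.
move=> x y u xa ya.
have E (v : R[i]) : (y + d)^-1 * v = (x + d)^-1 * v - (y - x) * ((x + d)^-1 * ((y + d)^-1 * v)).
  by field; rewrite !xd0.
exact: E.
Qed.

Lemma smooth_lipschitz V a (F : R[i] -> V) : smooth a F ->
  exists (M : R) (m : nat), 0 <= M /\ forall x y : R[i],
    a <= complex.Re x -> a <= complex.Re y ->
    nrm (F y - F x) <= M * ((1 + cabs x) * (1 + cabs y)) ^+ m * cabs (y - x).
Proof.
move=> [F1 [F2 [_ b1 b2 HF]]].
have [M [m [M0 H]]] : poly_bounded a (fun x y => F1 x + (y - x : R[i]^o) *: F2 x y).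
  by apply: poly_boundedD => //; apply: poly_boundedZ => //; exact: poly_bounded_sub.
exists M, m; split => // x y xa ya; rewrite (HF x y) //.
have -> : F x + (y - x) *: F1 x + (y - x) ^+ 2 *: F2 x y - F x =
   (y - x) *: (F1 x + (y - x) *: F2 x y).
  by rewrite scalerDr scalerA -expr2 addrAC (addrC (F x)) addrK addrC.
by rewrite nrmZ mulrC ler_wpM2r ?cabs_ge0 // H.
Qed.

End Smooth.

(** * Moving the line of integration to the right *)

Section Shift.
Context {R : realType}.
Implicit Types (V W : normedModType R[i]) (a b s h : R).
Local Notation mesh := (dyadic_mesh R).

(** The two powers of [|z|] are shared out: [|z|^(3/2)] dominates the inverse of the weight in
    [Im z], and the remaining [|z|^(1/2)] gives decay in the abscissa of the line. *)
Lemma inv_cabs2_le (z : R[i]) (B : R) : 0 <= B -> 1 + B <= complex.Re z ->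
  (cabs z ^+ 2)^-1 <= 4 * isq B * wt `|complex.Im z|.
Proof.
move=> B0 Bz; set s := `|complex.Im z|; have s0 : 0 <= s by exact: normr_ge0.
have zB := le_trans Bz (ler_Re_cabs z); have zs : s <= cabs z by exact: ler_normIm_cabs.
set r := cabs z in zB zs *.
have r0 : 0 < r by lra.
have rs : 1 + s <= 4 * r by lra.
have rs2 : 1 + s <= 2 * r by lra.
have sr : 0 <= Num.sqrt r by exact: sqrtr_ge0.
have h1 : Num.sqrt (1 + s) <= 2 * Num.sqrt r.
  rewrite -[2 in X in _ <= X]ger0_norm // -sqrtr_sqr -sqrtrM ?sqr_ge0 //.
  by rewrite ler_wsqrtr // expr2; lra.
have h2 : Num.sqrt (1 + B) <= Num.sqrt r by rewrite ler_wsqrtr.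
have q0 : 0 < (1 + s) * Num.sqrt (1 + s) * Num.sqrt (1 + B).
  by rewrite !mulr_gt0 ?sqrtr_gt0; lra.
rewrite /isq /wt -mulrA -invfM -[4]invrK -invfM lef_pV2 ?posrE ?exprn_gt0 //; last first.
  by rewrite mulr_gt0 ?invr_gt0 // mulrC.
rewrite ler_pdivrMl // mulrC.
have := ler_pM (mulr_ge0 (addr_ge0 ler01 s0) (sqrtr_ge0 (1 + s))) (sqrtr_ge0 (1 + B)) 
  (ler_pM (addr_ge0 ler01 s0) (sqrtr_ge0 (1 + s)) rs2 h1) h2.
move/le_trans; apply.
rewrite (_ : 2 * r * _ * _ = 4 * r * (Num.sqrt r ^+ 2)); last by ring.
by rewrite (sqr_sqrtr (ltW r0)) -mulrA -expr2.
Qed.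

Lemma isq0 : isq (0 : R) = 1.
Proof. by rewrite /isq addr0 sqrtr1 invr1. Qed.

Lemma wt_le_inv s : 0 <= s -> wt s <= (1 + s)^-1.
Proof.
move=> s0; rewrite /wt lef_pV2 ?posrE ?mulr_gt0 ?sqrtr_gt0; try lra.
by rewrite ler_peMr ?addr_ge0 // -[X in X <= _]sqrtr1 ler_wsqrtr //; lra.
Qed.

(** The increments [G (s + mesh n) - G s] telescope over the grid to [G n - G 0]; the local errors
    [D], weighted by the mesh, add up to [n * D]. *)
Lemma rsum_step V n (G H : R -> V) (k : R[i]) (D : R) :
  (forall s, 0 <= s -> s <= n%:R ->
    nrm (H s - G s - k *: (G (s + mesh n) - G s)) <= D) ->
  nrm (rsum n H - rsum n G - (mesh n)%:C *: (k *: (G n%:R - G 0))) <= n%:R * D.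
Proof.
move=> HG.
pose f j := (mesh n)%:C *: (H (j%:R * mesh n) - G (j%:R * mesh n)
   - k *: (G (j%:R * mesh n + mesh n) - G (j%:R * mesh n))).
have -> : rsum n H - rsum n G - (mesh n)%:C *: (k *: (G n%:R - G 0)) = \sum_(j < n * 2 ^ n) f j.
  have -> : G n%:R - G 0 = \sum_(j < n * 2 ^ n) (G (j%:R * mesh n + mesh n) - G (j%:R * mesh n)).
    have -> : n%:R = (n * 2 ^ n)%:R * mesh n by rewrite natrM -mulrA exp2_mesh mulr1.
    elim: (n * 2 ^ n)%N => [|K IH]; first by rewrite big_ord0 mul0r subrr.
    rewrite big_ord_recr /= -IH -[in LHS]natr1 mulrDl mul1r addrC.
    by rewrite addrA subrK.
  rewrite /rsum !scaler_sumr -!sumrB; apply: eq_bigr => j _.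
  by rewrite /f !scalerBr.
apply: le_trans (nrm_sum _ _ f) _.
apply: (@le_trans _ _ (\sum_(j < n * 2 ^ n) mesh n * D)).
  apply: ler_sum => j _; rewrite nrmZ cabs_ger0 ?mesh_ge0 // ler_wpM2l ?mesh_ge0 //.
  by apply: HG; [exact: node_ge0|apply: ltW; exact: node_lt].
rewrite sumr_const card_ord -[_ *+ _]mulr_natl mulrA natrM -[_ * _ * mesh n]mulrA.
by rewrite exp2_mesh mulr1.
Qed.

(* Cauchy-Riemann equation with increments [h] and [i h]; the sign [e] selects the
   upper or the lower half of the line. *)
Lemma smooth_step V a (F : R[i] -> V) : 0 <= a -> smooth a F ->
  exists (M : R) (m : nat), 0 <= M /\
  forall (b s h : R) (e : R), a <= b -> 0 <= s -> 0 <= h -> h <= 1 -> `|e| = 1 ->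
    nrm (F (Complex (b + h) (e * s)) - F (Complex b (e * s)) -
         Complex 0 (- e) *: (F (Complex b (e * (s + h))) - F (Complex b (e * s))))
    <= h ^+ 2 * (M * (2 + b + s) ^+ m).
Proof.
move=> a0 [F1 [F2 [_ _ [M [m [M0 HM]]] HF]]].
(* There are two Taylor remainders, and each has a product of two weights, both at most
   [2 + b + s]. *)
exists (2 * M), (m.*2); split; first by rewrite mulr_ge0.
move=> b s h e ab s0 h0 h1 e1.
set x := Complex b (e * s); set y := Complex (b + h) _; set z := Complex b (e * (s + h)).
have xa : a <= complex.Re x by [].
have ya : a <= complex.Re y by rewrite /=; lra.
have za : a <= complex.Re z by [].
have yx : y - x = h%:C.
  by rewrite -[LHS]/(Complex (b + h - b) (e * s - e * s)) subrr [b + h]addrC addrK.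
have zx : z - x = Complex 0 (e * h).
  by rewrite -[LHS]/(Complex (b - b) (e * (s + h) - e * s)) subrr; congr Complex; ring.
(* The rotated vertical increment equals the horizontal one, so the first-order terms cancel. *)
have kz : Complex 0 (- e) * (z - x) = h%:C.
  rewrite zx -[LHS]/(Complex (0 * 0 - (- e) * (e * h)) (0 * (e * h) + (- e) * 0)).
  rewrite !(mul0r, mulr0) add0r mulNr opprK addr0 mulrA.
  have -> : e * e = 1 by rewrite -expr2 -real_normK ?num_real // e1 expr1n.
  by rewrite mul1r.
rewrite (HF x y) // (HF x z) //.
have aux (u v w : V) : u + v + w - u = v + w by rewrite addrC -addrA addKr.
rewrite yx !aux.
rewrite scalerDr !scalerA kz (expr2 (z - x)) mulrA kz.
rewrite opprD addrACA subrr add0r.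
have w_le (w : R[i]) : cabs w <= 1 + b + s -> 0 <= (1 + cabs x) * (1 + cabs w) /\
  ((1 + cabs x) * (1 + cabs w)) ^+ m <= (2 + b + s) ^+ m.*2.
  move=> wb; have c0 := cabs_ge0 x; have c1 := cabs_ge0 w.
  split; first by rewrite mulr_ge0 //; lra.
  rewrite -mul2n exprM lerXn2r ?nnegrE ?exprn_ge0 ?mulr_ge0 //; try lra.
  rewrite expr2; apply: ler_pM; try lra.
  have : cabs x <= b + s; last by lra.
  apply: le_trans (ler_cabs x) _; rewrite /= normrM e1 mul1r !ger0_norm //; lra.
have cy : cabs y <= 1 + b + s.
  by apply: le_trans (ler_cabs y) _; rewrite /= normrM e1 mul1r !ger0_norm //; lra.
have cz : cabs z <= 1 + b + s.
  by apply: le_trans (ler_cabs z) _; rewrite /= normrM e1 mul1r !ger0_norm //; lra.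
have [_ wy] := w_le y cy; have [_ wz] := w_le z cz.
apply: le_trans (nrmB _ _ _) _; rewrite !nrmZ cabsX cabs_ger0 //.
rewrite zx cabsM cabsi normrM e1 mul1r cabs_ger0 // (ger0_norm h0) -expr2 -mulrDr.
rewrite ler_wpM2l ?exprn_ge0 // -[2]/(1 + 1) mulrDl mul1r mulrDl.
by apply: lerD; apply: le_trans (HM _ _ _ _) _ => //; rewrite ler_wpM2l.
Qed.

(** On both rays the telescoping sum leaves boundary values. Those at the real point [b] cancel
    because the rays carry opposite factors [-i] and [i]; those at height [n] are [O(1/n)] by the
    decay of [F]. The rest is the Taylor error of the [n * 2^n] cells of each ray. *)
Lemma lsum_step V a (F : R[i] -> V) (C : R) : 1 <= a -> smooth a F ->
  (forall x, a <= complex.Re x -> nrm (F x) <= C / cabs x ^+ 2) -> 0 <= C ->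
  exists (M : R) (m : nat), 0 <= M /\ forall (n : nat) (b : R), a <= b ->
    nrm (lsum n F (b + mesh n) - lsum n F b) <=
      mesh n * (8 * C / n.+1%:R) + n%:R * (mesh n ^+ 2 * (M * (2 + b + n%:R) ^+ m)).
Proof.
move=> a1 Fs FC C0; have a0 : 0 <= a by lra.
have [M [m [M0 H]]] := smooth_step V a F a0 Fs.
exists (2 * M), m; split; first by rewrite mulr_ge0.
move=> n b ab.
set h := mesh n; set D := h ^+ 2 * (M * (2 + b + n%:R) ^+ m).
have D_le s : 0 <= s -> s <= n%:R -> h ^+ 2 * (M * (2 + b + s) ^+ m) <= D.
  move=> s0 sn; rewrite ler_wpM2l ?sqr_ge0 // ler_wpM2l // lerXn2r ?nnegrE //; lra.
pose G (e : R) s := F (Complex b (e * s)).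
pose G' (e : R) s := F (Complex (b + h) (e * s)).
have step e : `|e| = 1 -> nrm (rsum n (G' e) - rsum n (G e) -
    h%:C *: (Complex 0 (- e) *: (G e n%:R - G e 0))) <= n%:R * D.
  move=> e1; apply: rsum_step => s s0 sn; apply: le_trans (D_le s s0 sn).
  by apply: H => //; [exact: mesh_ge0|exact: mesh_le1].
have lsumE c : lsum n F c = rsum n (fun s => F (Complex c (1 * s))) + rsum n (fun s => F (Complex c (-1 * s))).
  by rewrite /lsum; congr (_ + _); apply: eq_rsum => s _; rewrite ?mul1r ?mulN1r.
have FN (e : R) : `|e| = 1 -> nrm (F (Complex b (e * n%:R))) <= 4 * C / n.+1%:R.
  move=> e1; apply: le_trans (FC _ _) _ => //.
  rewrite [4 * C]mulrC -mulrA ler_wpM2l //.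
  apply: le_trans (inv_cabs2_le _ 0 (lexx _) _) _; first by rewrite addr0 /=; lra.
  rewrite isq0 mulr1 /= normrM e1 mul1r normr_nat ler_wpM2l //.
  by rewrite -nat1r; exact: wt_le_inv.
rewrite !lsumE -/(G 1) -/(G (-1)) -/(G' 1) -/(G' (-1)).
set S1 := rsum n (G 1); set S2 := rsum n (G (-1)).
set S1' := rsum n (G' 1); set S2' := rsum n (G' (-1)).
have n1 : `|1 : R| = 1 by exact: normr1.
have nN1 : `|-1 : R| = 1 by rewrite normrN1.
have st1 := step 1 n1; have st2 := step (-1) nN1.
rewrite -/S1 -/S1' in st1; rewrite -/S2 -/S2' in st2.
set T1 := h%:C *: _ in st1; set T2 := h%:C *: _ in st2.
have T12 : T1 + T2 = h%:C *: (Complex 0 (-1) *: (G 1 n%:R - G (-1) n%:R)).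
  rewrite /T1 /T2 -scalerDr; congr (_ *: _).
  have -> : Complex 0 (- -1) = - Complex 0 (-1) :> R[i] by apply/eqP; rewrite eq_complex /= oppr0 !eqxx.
  rewrite scaleNr -scalerBr; congr (_ *: _).
  have -> : G (-1) 0 = G 1 0 by rewrite /G !mulr0.
  by rewrite opprB addrA subrK.
have -> : S1' + S2' - (S1 + S2) = (S1' - S1 - T1) + (S2' - S2 - T2) + (T1 + T2).
  by rewrite [_ - T1 + _]addrACA -opprD subrK opprD addrACA.
apply: le_trans (nrmD _ _ _) _; rewrite addrC; apply: lerD.
  rewrite T12 nrmZ cabs_ger0 ?mesh_ge0 // ler_wpM2l ?mesh_ge0 // nrmZ cabsi normrN1 mul1r.
  apply: le_trans (nrmB _ _ _) _.
  have -> : 8 * C / n.+1%:R = 4 * C / n.+1%:R + 4 * C / n.+1%:R.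
    by rewrite -mulrDl; congr (_ / _); ring.
  exact: (lerD (FN 1 n1) (FN (-1) nN1)).
apply: le_trans (nrmD _ _ _) _; apply: le_trans (lerD st1 st2) _.
by rewrite /D -mulrDr le_eqVlt; apply/orP; left; apply/eqP; ring.
Qed.

(** The distance [B] is covered in [B * 2^n] moves of length [2^-n], each of which costs
    [2^-n * O(1/n)]. *)
Lemma lsum_shift V a (F : R[i] -> V) (C : R) : 1 <= a -> smooth a F ->
  (forall x, a <= complex.Re x -> nrm (F x) <= C / cabs x ^+ 2) -> 0 <= C ->
  forall B : nat, exists K : R, 0 <= K /\ forall n, nrm (lsum n F (a + B%:R) - lsum n F a) <= K / n.+1%:R.
Proof.
move=> a1 Fs FC C0 B; have [M [m [M0 H]]] := lsum_step V a F C a1 Fs FC C0.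
(* Beyond the [m] of the Taylor error, one power is for the length [n] of a ray and one leaves the
   quotient by [n + 1]. *)
have [D [D0 HD]] := pow_le_exp2 (R := R) (m + 2).
(* Chosen so that [2 + b + n <= E * (n + 1)] on every intermediate line [b <= a + B]. *)
pose E := 2 + a + B%:R; have E2 : 2 <= E by rewrite /E -addrA lerDl addr_ge0 //; lra.
have K0 : 0 <= 8 * C + M * E ^+ m * D by rewrite addr_ge0 ?mulr_ge0 ?exprn_ge0 //; lra.
exists (B%:R * (8 * C + M * E ^+ m * D)); split; first by rewrite mulr_ge0.
move=> n.
have n0 : 0 < n.+1%:R :> R by rewrite ltr0n.
have step b : a <= b -> b <= a + B%:R ->
    nrm (lsum n F (b + mesh n) - lsum n F b) <= mesh n * ((8 * C + M * E ^+ m * D) / n.+1%:R).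
  move=> ab bB; apply: le_trans (H n b ab) _.
  rewrite [X in _ <= _ * X]mulrDl [X in _ <= X]mulrDr lerD2l.
  have -> : n%:R * (mesh n ^+ 2 * (M * (2 + b + n%:R) ^+ m)) =
     mesh n * (n%:R * (mesh n * (M * (2 + b + n%:R) ^+ m))) by ring.
  rewrite ler_wpM2l ?mesh_ge0 // ler_pdivlMr //.
  apply: (@le_trans _ _ (n.+1%:R * (mesh n * (M * (E * n.+1%:R) ^+ m)) * n.+1%:R)).
    rewrite ler_wpM2r ?ler0n //.
    apply: ler_pM; rewrite ?ler_nat ?mulr_ge0 ?mesh_ge0 ?exprn_ge0 ?addr_ge0 //; try lra.
    rewrite ler_wpM2l ?mesh_ge0 // ler_wpM2l // lerXn2r ?nnegrE ?mulr_ge0 ?addr_ge0 //; try lra.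
    rewrite -[n.+1%:R]natr1 mulrDr mulr1 addrC; apply: lerD; last by rewrite /E; lra.
    by rewrite ler_peMl ?ler0n //; lra.
  have -> : n.+1%:R * (mesh n * (M * (E * n.+1%:R) ^+ m)) * n.+1%:R =
     M * E ^+ m * (n.+1%:R ^+ (m + 2) * mesh n) by rewrite exprMn exprD expr2; ring.
  rewrite ler_wpM2l ?mulr_ge0 ?exprn_ge0 //; first lra.
  by rewrite /dyadic_mesh ler_pdivrMr ?exprn_gt0 // HD.
set K := (8 * C + M * E ^+ m * D) / n.+1%:R in step *.
have IH j : (j <= B * 2 ^ n)%N -> nrm (lsum n F (a + j%:R * mesh n) - lsum n F a) <= j%:R * (mesh n * K).
  elim: j => [|j IHj] jB; first by rewrite !mul0r addr0 subrr nrm0.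
  have jn : j%:R * mesh n <= B%:R.
    have -> : B%:R = (B * 2 ^ n)%:R * mesh n by rewrite natrM -mulrA exp2_mesh mulr1.
    by rewrite ler_wpM2r ?mesh_ge0 // ler_nat ltnW.
  have h1 : nrm (lsum n F (a + j.+1%:R * mesh n) - lsum n F (a + j%:R * mesh n)) <= mesh n * K.
    have -> : a + j.+1%:R * mesh n = a + j%:R * mesh n + mesh n.
      by rewrite -[j.+1%:R]natr1 mulrDl mul1r addrA.
    by apply: step; rewrite ?lerDl ?node_ge0 // lerD2l.
  have h2 := IHj (ltnW jB).
  have := nrmD _ (lsum n F (a + j.+1%:R * mesh n) - lsum n F (a + j%:R * mesh n))
    (lsum n F (a + j%:R * mesh n) - lsum n F a).
  rewrite addrA subrK => /le_trans; apply.
  by rewrite -[X in _ <= X * _]natr1 [X in _ <= X]mulrDl mul1r addrC lerD.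
have := IH _ (leqnn _); rewrite natrM -mulrA exp2_mesh mulr1 -mulrA -/K => /le_trans; apply.
by rewrite -mulrA [_ * (mesh n * K)]mulrA exp2_mesh mul1r.
Qed.

Lemma lsum_bound V a (F : R[i] -> V) (C : R) n :
  (forall s, nrm (F (Complex a s)) <= C * wt `|s|) ->
  nrm (lsum n F a) <= C * 6.
Proof.
move=> H; rewrite /lsum (le_trans (nrmD _ _ _)) //.
have -> : C * 6 = C * 3 + C * 3 by ring.
apply: lerD; apply: rsum_bound => s s0; apply: le_trans (H _) _.
  by rewrite ger0_norm.
by rewrite normrN ger0_norm.
Qed.

(* Moving the line to [Re = a + B] changes the sums by [O(1/n)], and there they are
   bounded by a multiple of [isq B]. *)
Lemma lsum_cvg0 V a (F : R[i] -> V) (C : R) : 1 <= a -> smooth a F ->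
  (forall x, a <= complex.Re x -> nrm (F x) <= C / cabs x ^+ 2) -> 0 <= C ->
  (fun n => lsum n F a) @ \oo --> (0 : V).
Proof.
move=> a1 Fs FC C0; apply/cvg_nrmP; apply/cvgrPdist_lt => e e0.
have far (B n : nat) : nrm (lsum n F (a + B%:R)) <= 24 * C * isq B%:R.
  have -> : 24 * C * isq B%:R = (4 * C * isq B%:R) * 6 by ring.
  apply: lsum_bound => s; apply: le_trans (FC _ _) _; first by rewrite /= lerDl.
  have := inv_cabs2_le (Complex (a + B%:R) s) B%:R (ler0n _ _).
  by rewrite lerD2r => /(_ a1) /(ler_wpM2l C0); rewrite !mulrA [C * 4]mulrC.
have e2 : 0 < e / 2 by lra.
have : (fun n => 24 * C * isq n%:R) @ \oo --> (0 : R).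
  by rewrite -(mulr0 (24 * C)); apply: cvgM; [exact: cvg_cst|exact: isq_cvg0].
move/cvgrPdist_lt => /(_ _ e2) [B _ HB].
have [K [K0 HK]] := lsum_shift V a F C a1 Fs FC C0 B.
have : (fun n => K / n.+1%:R) @ \oo --> (0 : R).
  by rewrite -(mulr0 K); apply: cvgM; [exact: cvg_cst|exact: cvg_harmonic].
move/cvgrPdist_lt => /(_ _ e2); apply: filterS => n.
rewrite !sub0r !normrN subr0 (ger0_norm (nrm_ge0 _ _)).
rewrite ger0_norm ?divr_ge0 // => h.
have := HB B (leqnn B); rewrite /= sub0r normrN => hB.
have := nrmB _ (lsum n F (a + B%:R)) (lsum n F (a + B%:R) - lsum n F a).
rewrite opprB addrC subrK => /le_lt_trans; apply.
move: h hB (HK n) (far B n) (ler_norm (24 * C * isq B%:R)).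
by move: (24 * C * isq B%:R) (K / n.+1%:R) => u v; lra.
Qed.

End Shift.

(** * Estimates for the exponential *)

Section Kernel.
Context {R : realType}.
Implicit Types (x y : R) (z w : R[i]).
Local Notation mesh := (dyadic_mesh R).

Lemma sin_mvt y : 0 <= y -> exists2 c, (0 <= c <= y) & sin y = cos c * y.
Proof.
move=> y0; have [c cy E] := @MVT_segment R sin cos 0 y y0
  (fun x _ => is_derive_sin x) (continuous_subspaceT (@continuous_sin R)).
exists c; first by move: cy; rewrite in_itv.
by rewrite -[LHS]subr0 -{1}(@sin0 R) E subr0.
Qed.

Lemma norm_sin_le y : `|sin y| <= `|y|.
Proof.
wlog y0 : y / 0 <= y => [H|].
  have [y0|y0] := leP 0 y; first exact: H.
  by rewrite -normrN -sinN -[X in _ <= X]normrN; apply: H; lra.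
by have [c _ ->] := sin_mvt y y0; rewrite normrM ler_piMl ?cos_max.
Qed.

Lemma cosB1E y : cos y - 1 = - (2 * sin (y / 2) ^+ 2).
Proof.
have {1}-> : y = (y / 2) *+ 2 by rewrite -mulr_natr; field.
by rewrite cos_mulr2n cos2sin2 -mulr_natl; ring.
Qed.

Lemma norm_cosB1_le y : `|cos y - 1| <= `|y|.
Proof.
rewrite cosB1E normrN normrM normrX (ger0_norm (_ : 0 <= 2)) //.
have h1 := norm_sin_le (y / 2); have h2 := sin_max (y / 2).
have : `|y / 2| = `|y| / 2 by rewrite normrM (ger0_norm (_ : 0 <= 2^-1)) // invr_ge0.
have := normr_ge0 (sin (y / 2)); nra.
Qed.

Lemma norm_cosB1_le2 y : `|cos y - 1| <= y ^+ 2.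
Proof.
rewrite cosB1E normrN normrM normrX (ger0_norm (_ : 0 <= 2)) // -[y ^+ 2]ger0_norm ?sqr_ge0 // normrX.
have h1 := norm_sin_le (y / 2).
have h3 : `|y / 2| = `|y| / 2 by rewrite normrM (ger0_norm (_ : 0 <= 2^-1)) // invr_ge0.
have := normr_ge0 (sin (y / 2)); nra.
Qed.

Lemma norm_sinB_le y : `|sin y - y| <= y ^+ 2.
Proof.
wlog y0 : y / 0 <= y => [H|].
  have [y0|y0] := leP 0 y; first exact: H.
  by rewrite -normrN opprB addrC -sinN -sqrrN -[X in _ + X]opprK; apply: H; lra.
have [c /andP[c0 cy] ->] := sin_mvt y y0.
rewrite -[X in _ - X]mul1r -mulrBl normrM (ger0_norm y0) expr2 ler_wpM2r //.
by rewrite (le_trans (norm_cosB1_le c)) // ger0_norm.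
Qed.

Lemma norm_expRB1_le x : x <= 0 -> `|expR x - 1| <= `|x|.
Proof.
move=> x0; have h1 := expR_ge1Dx x; have h2 : expR x <= 1 by rewrite expR_le1.
by rewrite !ler0_norm //; lra.
Qed.

Lemma norm_expRB1B_le x : x <= 0 -> `|expR x - 1 - x| <= x ^+ 2.
Proof.
move=> x0; have h := expR_ge1Dx x; rewrite ger0_norm; last by lra.
(* From [1 - x <= e^(-x)] follows [e^x <= 1 / (1 - x)], hence
   [e^x - 1 - x <= x^2 / (1 - x) <= x^2]. *)
have h2 := expR_ge1Dx (- x); rewrite expRN in h2.
have e0 := expR_gt0 x.
have h3 : (1 - x) * expR x <= 1.
  by rewrite -[X in _ <= X](@mulVf _ (expR x)) ?gt_eqF // ler_wpM2r // ltW.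
by nra.
Qed.

Lemma cabs_cexpB1_le z : complex.Re z <= 0 -> cabs (cexp z - 1) <= 3 * cabs z.
Proof.
move=> z0; have hx := ler_normRe_cabs z; have hy := ler_normIm_cabs z.
case: z z0 hx hy => x y /= x0 hx hy.
apply: le_trans (ler_cabs _) _.
rewrite cexpE /= subr0.
have e0 := expR_ge0 x; have e1 : expR x <= 1 by rewrite expR_le1.
have h1 := norm_expRB1_le x x0; have h2 := norm_cosB1_le y; have h3 := norm_sin_le y.
have -> : expR x * cos y - 1 = (expR x - 1) + expR x * (cos y - 1) by ring.
have := ler_normD (expR x - 1) (expR x * (cos y - 1)).
rewrite !normrM (ger0_norm e0).
have : expR x * `|cos y - 1| <= `|cos y - 1| by rewrite ler_piMl.
have : expR x * `|sin y| <= `|sin y| by rewrite ler_piMl.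
by lra.
Qed.

Lemma cabs_cexpB1B_le z : complex.Re z <= 0 -> cabs (cexp z - 1 - z) <= 4 * cabs z ^+ 2.
Proof.
move=> z0; rewrite [cabs z]cabsE sqr_sqrtr ?addr_ge0 ?sqr_ge0 //.
case: z z0 => x y /= x0.
apply: le_trans (ler_cabs _) _.
rewrite cexpE /= subr0.
have e0 := expR_ge0 x; have e1 : expR x <= 1 by rewrite expR_le1.
have h1 := norm_expRB1_le x x0; have h2 := norm_cosB1_le2 y; have h3 := norm_sin_le y.
have h4 := norm_sinB_le y; have h5 := norm_expRB1B_le x x0.
have -> : expR x * cos y - 1 - x = (expR x - 1 - x) + expR x * (cos y - 1) by ring.
have -> : expR x * sin y - y = (expR x - 1) * sin y + (sin y - y) by ring.
have := ler_normD (expR x - 1 - x) (expR x * (cos y - 1)).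
have := ler_normD ((expR x - 1) * sin y) (sin y - y).
rewrite !normrM (ger0_norm e0).
have : expR x * `|cos y - 1| <= `|cos y - 1| by rewrite ler_piMl.
have : `|expR x - 1| * `|sin y| <= `|x| * `|y| by rewrite ler_pM.
have : 2 * (`|x| * `|y|) <= x ^+ 2 + y ^+ 2.
  rewrite -[x ^+ 2]real_normK ?num_real // -[y ^+ 2]real_normK ?num_real //.
  by have := sqr_ge0 (`|x| - `|y|); rewrite sqrrB -mulr_natr; lra.
have := sqr_ge0 x; have := sqr_ge0 y; lra.
Qed.

Lemma cabs_cexpB1_le2 z : complex.Re z <= 0 -> cabs (cexp z - 1) <= 2.
Proof.
move=> z0; apply: le_trans (cabsD _ _) _; rewrite cabsN cabs_cexp (@cabs_ger0 _ 1) //.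
by have : expR (complex.Re z) <= 1; [rewrite expR_le1|lra].
Qed.

(** Interpolates between the linear bound, for small [z], and the constant bound, for large [z].
    Only half a power of [|z|] is spent, which the decay [O(|z|^-2)] of the integrands can
    afford. *)
Lemma cabs_cexpB1_sqrt z : complex.Re z <= 0 ->
  cabs (cexp z - 1) <= 3 * Num.sqrt (cabs z).
Proof.
move=> z0; have h1 := cabs_cexpB1_le z z0; have h2 := cabs_cexpB1_le2 z z0.
have r0 := sqrtr_ge0 (cabs z); have := sqr_sqrtr (cabs_ge0 z).
set r := Num.sqrt _ in r0 * => rr; have [r1|r1] := leP r 1; nra.
Qed.

(** The same interpolation, between the quadratic and the linear bound. *)
Lemma cabs_cexpB1B_sqrt z : complex.Re z <= 0 ->
  cabs (cexp z - 1 - z) <= 4 * (cabs z * Num.sqrt (cabs z)).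
Proof.
move=> z0; have h1 := cabs_cexpB1_le z z0; have h2 := cabs_cexpB1B_le z z0.
have := cabsD (cexp z - 1) (- z); rewrite cabsN => h3.
have r0 := sqrtr_ge0 (cabs z); have := sqr_sqrtr (cabs_ge0 z).
set r := Num.sqrt _ in r0 * => rr; have [r1|r1] := leP r 1.
  by apply: le_trans h2 _; rewrite ler_wpM2l // expr2 ler_wpM2l ?cabs_ge0 // -rr; nra.
by apply: le_trans h3 _; have := cabs_ge0 z; nra.
Qed.

(** A geometric sum: [d / (1 - e^(-d)) <= 1 + d] because [(1 + d) e^(-d) <= 1]. *)
Lemma sum_mesh_exp K (d : R) : 0 <= d -> d <= 1 ->
  \sum_(i < K) d * expR (- (i%:R * d)) <= 2.
Proof.
move=> d0 d1.
suff : \sum_(i < K) d * expR (- (i%:R * d)) <= (1 + d) * (1 - expR (- (K%:R * d))).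
  have : expR (- (K%:R * d)) >= 0 by exact: expR_ge0.
  by move=> h1 h2; apply: le_trans h2 _; nra.
elim: K => [|K IH]; first by rewrite big_ord0 mul0r oppr0 expR0 subrr mulr0.
rewrite big_ord_recr /=; apply: le_trans (lerD IH (lexx _)) _.
have -> : - (K.+1%:R * d) = - (K%:R * d) + - d by rewrite -natr1; ring.
rewrite expRD; have := expR_ge0 (- (K%:R * d)); set a := expR _ => a0.
have : (1 + d) * expR (- d) <= 1.
  by rewrite expRN ler_pdivrMr ?expR_gt0 // mul1r expR_ge1Dx.
by move=> h; nra.
Qed.

(** Riemann sum for [int_0^oo e^(w t) dt = - w^-1], to be used with [w = z - mu]. *)
Definition time_kernel n w : R[i] :=
  \sum_(i < n * 2 ^ n) (mesh n)%:C * cexp (w * (i%:R * mesh n)%:C).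

Lemma time_kernel_approx n w : complex.Re w <= -1 ->
  cabs (time_kernel n w + w^-1) <=
    8 * (Num.sqrt (mesh n) * Num.sqrt (cabs w)) + expR (- n%:R).
Proof.
move=> w1; have wn0 : w != 0.
  by apply/eqP => w0; move: w1; rewrite w0 /= lerNr oppr0 ler10.
have w1' : 1 <= cabs w.
  by have := ler_normRe_cabs w; rewrite ler0_norm; lra.
set d := mesh n; have d0 : 0 <= d := mesh_ge0 n.
(* [g i] is the value of the sum minus that of the integral on the cell number [i]. The exact
   integrals telescope to [(e^(w n) - 1) / w]. *)
pose g i := cexp (w * (i%:R * d)%:C) * (d%:C - (cexp (w * d%:C) - 1) / w).
have E : time_kernel n w + w^-1 = \sum_(i < n * 2 ^ n) g i + cexp (w * n%:R%:C) / w.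
  have -> : n%:R = (n * 2 ^ n)%:R * d :> R by rewrite natrM -mulrA exp2_mesh mulr1.
  rewrite /time_kernel -/d; elim: (n * 2 ^ n)%N => [|K IH].
    by rewrite !big_ord0 mul0r mulr0 cexp0 !add0r mul1r.
  rewrite !big_ord_recr /= addrAC IH /g.
  have -> : cexp (w * (K.+1%:R * d)%:C) = cexp (w * (K%:R * d)%:C) * cexp (w * d%:C).
    by rewrite -cexpD -mulrDr -rmorphD /= -natr1 mulrDl mul1r.
  by field.
rewrite E; apply: le_trans (cabsD _ _) _; apply: lerD.
  have gs := @nrm_sum R R[i]^o (n * 2 ^ n) g.
  apply: le_trans gs _.
  set q := Num.sqrt d * Num.sqrt (cabs w).
  have q0 : 0 <= q by rewrite mulr_ge0 ?sqrtr_ge0.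
  have -> : 8 * q = 4 * q * 2 by ring.
  apply: le_trans (ler_wpM2l (mulr_ge0 (ler0n _ 4) q0) (sum_mesh_exp (n * 2 ^ n) d d0 (mesh_le1 n))).
  rewrite mulr_sumr; apply: ler_sum => i _; rewrite -[nrm _]/(cabs (g i)) /g.
  rewrite cabsM cabs_cexp ReMr.
  have -> : 4 * q * (d * expR (- (i%:R * d))) = expR (- (i%:R * d)) * (4 * q * d) by ring.
  apply: ler_pM; rewrite ?expR_ge0 ?cabs_ge0 //.
    by rewrite ler_expR; have : 0 <= i%:R * d := node_ge0 _ _; nra.
  have -> : d%:C - (cexp (w * d%:C) - 1) / w = - ((cexp (w * d%:C) - 1 - w * d%:C) / w) by field.
  rewrite cabsN cabsM cabsV ler_pdivrMr; last by lra.
  apply: le_trans (cabs_cexpB1B_sqrt _ _) _; first by rewrite ReMr; nra.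
  rewrite cabsM cabs_ger0 // sqrtrM ?cabs_ge0 // le_eqVlt; apply/orP; left; apply/eqP.
  by rewrite /q; ring.
rewrite cabsM cabs_cexp ReMr cabsV ler_pdivrMr; last by lra.
apply: le_trans (_ : expR (- n%:R) * 1 <= _); last by rewrite ler_wpM2l ?expR_ge0.
rewrite mulr1 ler_expR; have : 0 <= n%:R :> R by []; nra.
Qed.

End Kernel.

(** * Scalar kernels on a vertical line *)

Section LineSums.
Context {R : realType}.
Implicit Types (V W : normedModType R[i]) (a : R).
Local Notation mesh := (dyadic_mesh R).

Lemma lsumD V n a (F G : R[i] -> V) :
  lsum n (fun z => F z + G z) a = lsum n F a + lsum n G a.
Proof. by rewrite /lsum !rsumD addrACA. Qed.

Lemma lsumB V n a (F G : R[i] -> V) :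
  lsum n (fun z => F z - G z) a = lsum n F a - lsum n G a.
Proof. by rewrite /lsum !rsumB opprD addrACA. Qed.

Lemma lsum_linear V W n a (T : V -> W) (F : R[i] -> V) :
  (forall c x y, T (c *: x + y) = c *: T x + T y) ->
  lsum n (fun z => T (F z)) a = T (lsum n F a).
Proof.
move=> Tl; have TD x y : T (x + y) = T x + T y by rewrite -[x]scale1r Tl !scale1r.
by rewrite /lsum TD -!(rsum_linear _ _ _ T).
Qed.

Lemma lsumZ V n a (c : R[i]) (F : R[i] -> V) :
  lsum n (fun z => c *: F z) a = c *: lsum n F a.
Proof. by rewrite /lsum !rsumZ scalerDr. Qed.

Lemma eq_lsum V n a (F G : R[i] -> V) :
  (forall z, complex.Re z = a -> F z = G z) -> lsum n F a = lsum n G a.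
Proof. by move=> FG; congr (_ + _); apply: eq_rsum => s _; rewrite FG. Qed.

(** On the line [Re z = a] the point [2 a - z] is the conjugate of [z], so the two rays are
    exchanged. A pole to the right of the line thereby becomes one to the left. *)
Lemma lsum_reflect V n a (F : R[i] -> V) :
  lsum n (fun z => F ((2 * a)%:C - z)) a = lsum n F a.
Proof.
rewrite /lsum addrC; congr (_ + _); apply: eq_rsum => s _; congr F;
  apply/eqP; rewrite eq_complex /=; apply/andP; split; apply/eqP; ring.
Qed.

Lemma cvgZ_nrm V (f : nat -> V) (l : V) (c : R[i]) :
  f @ \oo --> l -> (fun n => c *: f n) @ \oo --> c *: l.
Proof.
move=> fl; apply: (cvg_bounded_op V V (fun x => c *: x) (cabs c)) => //.
  by move=> x y; rewrite scalerBr.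
by move=> x; rewrite nrmZ.
Qed.

Lemma cvg_scaler V (f : nat -> R[i]^o) (l : R[i]^o) (y : V) :
  f @ \oo --> l -> (fun n => f n *: y) @ \oo --> l *: y.
Proof.
move=> fl; apply: (cvg_bounded_op R[i]^o V (fun c => c *: y) (nrm y)) => //.
  by move=> c d; rewrite scalerBl.
by move=> c; rewrite nrmZ mulrC.
Qed.

Lemma eq_cvgn V (f g : nat -> V) (l : V) :
  (forall n, f n = g n) -> f @ \oo --> l -> g @ \oo --> l.
Proof. by move=> /funext ->. Qed.

(* Its limit is [pi / a]; only convergence to a positive number is used. *)
Definition normalizer a n : R :=
  \sum_(k < n * 2 ^ n) mesh n * (2 / (a ^+ 2 + (k%:R * mesh n) ^+ 2)).

(** On the line [2 a - z] is the conjugate of [z], so the product is [a^2 + s^2]. *)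
Lemma normalizerE a n : 0 < a ->
  lsum n (fun z => (z * ((2 * a)%:C - z))^-1 : R[i]^o) a = (normalizer a n)%:C.
Proof.
move=> a0; rewrite /normalizer rmorph_sum /= /lsum /rsum -big_split /=.
apply: eq_bigr => k _; set s := k%:R * mesh n.
have E (t : R) : (Complex a t * ((2 * a)%:C - Complex a t))^-1 = ((a ^+ 2 + t ^+ 2)^-1)%:C.
  rewrite fmorphV /=; congr (_^-1); apply/eqP; rewrite eq_complex /=.
  by apply/andP; split; apply/eqP; ring.
rewrite !E sqrrN -scalerDr -[_ *: _]/(_ * _) -!rmorphD -rmorphM /=; congr (_%:C).
by rewrite -mulr2n -[_ *+ _]mulr_natl.
Qed.

Lemma normalizer_cvg a : 1 <= a ->
  exists l : R, 0 < l /\ (normalizer a) @ \oo --> l.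
Proof.
move=> a1; have a0 : 0 < a by lra.
pose G (s : R) : R[i]^o := (2 / (a ^+ 2 + s ^+ 2))%:C.
have GE n : rsum n G = (normalizer a n)%:C.
  rewrite /normalizer rmorph_sum /=; apply: eq_bigr => k _.
  by rewrite rmorphM.
have a2 : 1 <= a ^+ 2 by rewrite exprn_ege1.
have d0 s : 0 < a ^+ 2 + s ^+ 2 by have := sqr_ge0 s; lra.
have d1 s : 1 <= a ^+ 2 + s ^+ 2 by have := sqr_ge0 s; lra.
have [C [C0 H]] : exists C', 0 <= C' /\
    forall n, nrm (rsum n.+1 G - rsum n G) <= C' * wt n%:R.
  (* [8] is twice the constant of [inv_cabs2_le]; the difference quotient is at most
     [2 (t + s) <= 4 (1 + t)]. *)
  apply: (rsum_refine R[i]^o G 8 4 1).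
    move=> s s0; rewrite -[nrm _]/(cabs _) cabs_ger0 ?divr_ge0 ?(ltW (d0 s)) //.
    have := inv_cabs2_le (Complex a s) 0 (lexx _).
    rewrite addr0 isq0 mulr1 cabsE /= (sqr_sqrtr (ltW (d0 s))) (ger0_norm s0) => /(_ a1).
    by lra.
  move=> s t s0 st; rewrite -[nrm _]/(cabs ((2 / (a ^+ 2 + t ^+ 2))%:C - (2 / (a ^+ 2 + s ^+ 2))%:C)).
  rewrite -rmorphB /= cabs_real.
  have -> : 2 / (a ^+ 2 + t ^+ 2) - 2 / (a ^+ 2 + s ^+ 2) =
     - ((2 * (t + s) * (t - s)) / ((a ^+ 2 + t ^+ 2) * (a ^+ 2 + s ^+ 2))).
    by field; rewrite !gt_eqF.
  rewrite normrN ger0_norm; last first.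
    by rewrite divr_ge0 ?mulr_ge0 ?(ltW (d0 _)) //; lra.
  rewrite expr1 ler_pdivrMr ?mulr_gt0 //.
  apply: (@le_trans _ _ (4 * (1 + t) * (t - s))).
    by rewrite ler_wpM2r //; lra.
  by rewrite ler_peMr ?mulr_ge0 //; [lra|lra|rewrite mulr_ege1].
have [l Hl] : exists l : R, (normalizer a) @ \oo --> l.
  apply: (@real_cvg_telescope R _ (fun n => C * (8 * isq n%:R))).
    move=> n; have := H n; rewrite !GE -rmorphB -[nrm _]/(cabs _) cabs_real => /le_trans; apply.
    by rewrite -mulrBr ler_wpM2l // wt_telescope_nat.
  rewrite -(mulr0 C); apply: cvgM; first exact: cvg_cst.
  by rewrite -(mulr0 8); apply: cvgM; [exact: cvg_cst|exact: isq_cvg0].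
(* For [n >= 1] the [2^n] nodes in [[0, 1)] alone contribute at least [2 / (a^2 + 1)]. *)
exists l; split => //; apply: (@lt_le_trans _ _ (2 / (a ^+ 2 + 1))).
  by rewrite divr_gt0 //; have := d0 1; rewrite expr1n.
rewrite -(cvg_lim _ Hl) //; apply: limr_ge; first by apply/cvg_ex; exists l.
exists 1%N => // n /= n1.
have nE : (n * 2 ^ n = 2 ^ n + n.-1 * 2 ^ n)%N by rewrite -mulSn prednK.
rewrite /normalizer nE (big_ord_tail (fun k => mesh n * (2 / (a ^+ 2 + (k%:R * mesh n) ^+ 2)))).
apply: (@le_trans _ _ (\sum_(k < 2 ^ n) mesh n * (2 / (a ^+ 2 + 1)))).
  rewrite sumr_const card_ord -[X in _ <= X]mulr_natl mulrA exp2_mesh mul1r //.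
rewrite -[X in X <= _]addr0; apply: lerD.
  apply: ler_sum => k _; rewrite ler_wpM2l ?mesh_ge0 // ler_wpM2l // lef_pV2 ?posrE //; last first.
    by have := d0 1; rewrite expr1n.
  rewrite lerD2l exprn_ile1 ?node_ge0 //.
  by rewrite -[X in _ <= X](exp2_mesh n) ler_wpM2r ?mesh_ge0 // ler_nat ltnW.
by apply: sumr_ge0 => k _; rewrite mulr_ge0 ?mesh_ge0 // divr_ge0 // (ltW (d0 _)).
Qed.

Lemma le_inv_cabs_shift (z d : R[i]) : 1 <= complex.Re (z + d) -> z != 0 ->
  (cabs (z + d))^-1 <= (1 + cabs d) * (cabs z)^-1.
Proof.
move=> h z0; have h1 := le_trans h (ler_Re_cabs _).
have cz : 0 < cabs z by rewrite lt_neqAle cabs_ge0 eq_sym cabs_eq0 z0.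
rewrite ler_pdivlMr // mulrC ler_pdivrMr; last by lra.
have := cabsD (z + d) (- d); rewrite addrK cabsN.
have := cabs_ge0 d; nra.
Qed.

(** Both poles lie at least [1] to the left of the line, so the integrand is smooth and [O(|z|^-2)]
    on the half-plane to the right. *)
Lemma lsum_inv_cvg0 a (d e : R[i]) : 1 <= a ->
  1 - a <= complex.Re d -> 1 - a <= complex.Re e ->
  (fun n => lsum n (fun z => ((z + d)^-1 * (z + e)^-1) : R[i]^o) a) @ \oo --> (0 : R[i]^o).
Proof.
move=> a1 ad ae.
apply: (lsum_cvg0 R[i]^o a _ ((1 + cabs d) * (1 + cabs e)) a1).
- exact: (smoothZ R[i]^o a (fun z => (z + d)^-1) (fun z => (z + e)^-1) (smooth_inv _ _ ad) (smooth_inv _ _ ae)).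
- move=> z za; rewrite -[nrm _]/(cabs _) cabsM !cabsV expr2 invfM.
  have z0 : z != 0 by apply: Re_gt0_neq0; lra.
  rewrite mulrACA; apply: ler_pM; rewrite ?invr_ge0 ?cabs_ge0 //;
    by apply: le_inv_cabs_shift => //; rewrite ReD; lra.
- by rewrite mulr_ge0 ?addr_ge0 ?cabs_ge0.
Qed.

Lemma smooth_inv_exp a p : 1 <= a -> smooth a (fun z => (z ^+ p.+1)^-1 : R[i]^o).
Proof.
move=> a1; have s1 : smooth a (fun z => z^-1 : R[i]^o).
  have := smooth_inv a 0; rewrite /= subr_le0 => /(_ a1).
  by congr smooth; apply/funext => z; rewrite addr0.
elim: p => [|p IH]; first by move: s1; congr smooth; apply/funext => z; rewrite expr1.
have := smoothZ R[i]^o a _ _ s1 IH; congr smooth; apply/funext => z.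
by rewrite (exprS z p.+1) invfM.
Qed.

Lemma lsum_inv_exp_cvg0 a p : 1 <= a ->
  (fun n => lsum n (fun z => (z ^+ p.+2)^-1 : R[i]^o) a) @ \oo --> (0 : R[i]^o).
Proof.
move=> a1; apply: (lsum_cvg0 R[i]^o a _ 1 a1) => //; first exact: smooth_inv_exp.
move=> z za; rewrite -[nrm _]/(cabs _) cabsV cabsX mul1r.
have z1 : 1 <= cabs z by rewrite (le_trans a1) // (le_trans za) ?ler_Re_cabs.
by rewrite lef_pV2 ?posrE ?exprn_gt0 ?ler_weXn2l //; lra.
Qed.

(** Cauchy's formula for [z^-(p+1)] at [mu], obtained from partial fractions and vanishing line
    integrals. The constant [c = 2 a l], with [l] the limit of the normalizer, is the same for all
    [p] and [mu]. *)
Lemma lsum_cauchy_kernel a : 1 <= a ->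
  exists c : R, 0 < c /\ forall p (mu : R[i]), a + 1 <= complex.Re mu ->
    (fun n => lsum n (fun z => ((z ^+ p.+1)^-1 * (mu - z)^-1) : R[i]^o) a) @ \oo
      --> (c%:C * (mu ^+ p.+1)^-1 : R[i]^o).
Proof.
move=> a1; have [l [l0 Hl]] := normalizer_cvg a a1.
exists (2 * a * l); split; first by rewrite !mulr_gt0 //; lra.
move=> p mu amu.
have mu0 : mu != 0 by apply: Re_gt0_neq0; lra.
have zmu (z : R[i]) : complex.Re z = a -> mu - z != 0.
  by move=> za; apply: Re_gt0_neq0; rewrite ReD ReN za; lra.
have z2a (z : R[i]) : complex.Re z = a -> (2 * a)%:C - z != 0.
  by move=> za; apply: Re_gt0_neq0; rewrite ReD ReN za /=; lra.
have z0 (z : R[i]) : complex.Re z = a -> z != 0.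
  by move=> za; apply: Re_gt0_neq0; rewrite za; lra.
elim: p => [|p IH]; last first.
  (* Partial fractions: [1 / (z^(p+2) (mu - z)) = mu^-1 (1 / z^(p+2) + 1 / (z^(p+1) (mu - z)))], and
     the first summand integrates to [0]. *)
  have -> : (2 * a * l)%:C * (mu ^+ p.+2)^-1 = mu^-1 *: (0 + (2 * a * l)%:C * (mu ^+ p.+1)^-1) :> R[i]^o.
    by rewrite add0r -[_ *: _]/(_ * _) (exprS mu p.+1) invfM mulrCA.
  apply: eq_cvgn (cvgZ_nrm _ _ _ mu^-1 (cvgD (lsum_inv_exp_cvg0 a p a1) IH)) => n.
  rewrite fctE -lsumD -lsumZ; apply: eq_lsum => z za; rewrite -[_ *: _]/(_ * _) !exprS.
  have zn0 : z ^+ p != 0 by rewrite expf_neq0 // z0.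
  by field; rewrite ?zn0 ?mu0 ?(z0 z za) ?(zmu z za).
(* Both poles [mu] and [2 a] lie to the right; reflection takes them to [2 a - mu] and [0], and
   [a + 1 <= Re mu] puts the former far enough to the left. *)
have refl : (fun n => lsum n (fun z => ((mu - z)^-1 * ((2 * a)%:C - z)^-1) : R[i]^o) a) @ \oo --> (0 : R[i]^o).
  have := lsum_inv_cvg0 a (mu - (2 * a)%:C) 0 a1; rewrite ReD ReN /=.
  have h1 : 1 - a <= complex.Re mu - 2 * a by lra.
  have h2 : 1 - a <= 0 by lra.
  move=> /(_ h1 h2); apply: eq_cvgn => n.
  rewrite -lsum_reflect; apply: eq_lsum => z za; rewrite addr0; congr (_^-1 * _).
  by rewrite addrAC addrCA subrr addr0.
have norml : (fun n => lsum n (fun z => (z * ((2 * a)%:C - z))^-1 : R[i]^o) a) @ \oo --> (l%:C : R[i]^o).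
  apply/cvg_nrmP.
  have -> : (fun n => nrm (lsum n (fun z => (z * ((2 * a)%:C - z))^-1 : R[i]^o) a - l%:C)) =
      (fun n => `|normalizer a n - l|).
    by apply/funext => n; rewrite normalizerE ?(lt_le_trans ltr01) // -rmorphB -[nrm _]/(cabs _) cabs_real.
  apply/cvgrPdist_lt => e e0; have /cvgrPdist_lt /(_ e e0) := Hl; apply: filterS => n.
  by rewrite sub0r normrN normr_id distrC.
(* Partial fractions through the auxiliary pole [2 a]: [mu / (z (mu - z)) = 2 a / (z (2 a - z)) + (2
   a - mu) / ((mu - z) (2 a - z))]. *)
have -> : (2 * a * l)%:C * (mu ^+ 1)^-1 = mu^-1 *: ((2 * a)%:C *: l%:C + ((2 * a)%:C - mu) *: 0) :> R[i]^o.
  by rewrite scaler0 addr0 -![_ *: _]/(_ * _) -rmorphM expr1 mulrC.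
apply: eq_cvgn (cvgZ_nrm _ _ _ mu^-1 (cvgD (cvgZ_nrm _ _ _ (2 * a)%:C norml)
  (cvgZ_nrm _ _ _ ((2 * a)%:C - mu) refl))) => n.
rewrite fctE -!lsumZ -lsumD -lsumZ; apply: eq_lsum => z za; rewrite -![_ *: _]/(_ * _) expr1.
move: ((2 * a)%:C) (z2a z za) => b zb.
by field; rewrite mu0 (z0 z za) (zmu z za) zb.
Qed.

End LineSums.

(** * Inverse Laplace transform *)

Section Inversion.
Context {R : realType}.
Local Notation mesh := (dyadic_mesh R).
Variables (V : completeNormedModType R[i]) (a C : R) (F : R[i] -> V).
Hypotheses (a1 : 1 <= a) (C0 : 0 <= C) (Fs : smooth a F).
Hypothesis FC : forall z, a <= complex.Re z -> nrm (F z) <= C / cabs z ^+ 2.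

Let a0 : 0 <= a. Proof. exact: le_trans ler01 a1. Qed.

Definition exp_lsum (t : R) (n : nat) : V :=
  lsum n (fun z => cexp (z * t%:C) *: F z) a.

(** The normalizing factor is left out here; it enters as [c^-1] in the final construction. *)
Definition inv_laplace (t : R) : V := limn (exp_lsum t).

Lemma line_bound z : complex.Re z = a -> nrm (F z) <= 4 * C * wt `|complex.Im z|.
Proof.
move=> za; apply: le_trans (FC z _) _; first by rewrite za.
rewrite [4 * C]mulrC -mulrA ler_wpM2l //.
apply: le_trans (inv_cabs2_le z 0 (lexx _) _) _; first by rewrite za addr0.
by rewrite isq0 mulr1.
Qed.

(** The factor [(1 + |Im z|)^(1/2)] reduces the decay from the power [2] to the power [3/2], which
    is still that of [wt]. *)
Lemma line_bound_sqrt z : complex.Re z = a ->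
  nrm (F z) * Num.sqrt (1 + `|complex.Im z|) <= 4 * C * wt `|complex.Im z|.
Proof.
move=> za; set s := `|_|; have s0 : 0 <= s by exact: normr_ge0.
have h1 : 1 + s <= 2 * cabs z.
  have hr := ler_Re_cabs z; have hs : s <= cabs z by exact: ler_normIm_cabs.
  by rewrite za in hr; move: a1 hr hs; lra.
have q0 : 0 < Num.sqrt (1 + s) by rewrite sqrtr_gt0; lra.
have s1 : 0 < 1 + s by lra.
rewrite -ler_pdivlMr //; apply: le_trans (FC z _) _; first by rewrite za.
rewrite [4 * C]mulrC -!mulrA ler_wpM2l // /wt -invfM -mulrA -expr2 sqr_sqrtr ?(ltW s1) //.
have c0 : 0 < cabs z by lra.
have p0 : 0 < 4^-1 * (1 + s) ^+ 2 by rewrite mulr_gt0 ?invr_gt0 ?exprn_gt0.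
rewrite -[4]invrK -invfM lef_pV2 ?posrE ?exprn_gt0 //.
by rewrite ler_pdivrMl //; nra.
Qed.

Lemma exp_lsum_cvg t : 0 <= t -> exp_lsum t @ \oo --> inv_laplace t.
Proof.
move=> t0.
have [M [m [M0 HM]]] := smooth_lipschitz V a F Fs.
have side (e : R) : `|e| = 1 ->
  exists l : V, (fun n => rsum n (fun s => cexp (Complex a (e * s) * t%:C) *: F (Complex a (e * s)))) @ \oo --> l.
  move=> e1.
  (* In the Lipschitz constant, the term with [M] is the variation of [F];
     [12 * t * C = 3 * t * (4 * C)] is the variation of the exponential times the bound on [F]. *)
  apply: (rsum_cvg V _ (expR (a * t) * (4 * C))
     (expR (a * t) * (M * (1 + a) ^+ m.*2 + 12 * t * C)) m.*2).
    move=> s s0; rewrite nrmZ cabs_cexp ReMr /= -mulrA ler_wpM2l ?expR_ge0 //.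
    by apply: le_trans (line_bound _ _) _ => //=; rewrite normrM e1 mul1r ger0_norm.
  move=> s s' s0 ss'; have s'0 : 0 <= s' by lra.
  set x := Complex a (e * s); set y := Complex a (e * s').
  have -> : cexp (y * t%:C) *: F y - cexp (x * t%:C) *: F x =
    cexp (y * t%:C) *: (F y - F x) + cexp (x * t%:C) *: ((cexp ((y - x) * t%:C) - 1) *: F x).
    have E : cexp (x * t%:C) * cexp ((y - x) * t%:C) = cexp (y * t%:C).
      by rewrite -cexpD -mulrDl addrC subrK.
    by rewrite scalerA mulrBr mulr1 E scalerBl scalerBr addrA subrK.
  have yx : y - x = Complex 0 (e * (s' - s)).
    rewrite -[LHS]/(Complex (a - a) (e * s' - e * s)) subrr; congr Complex; ring.
  have cyx : cabs (y - x) = s' - s.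
    by rewrite yx cabsi normrM e1 mul1r ger0_norm; lra.
  have cx (r : R) : 0 <= r -> r <= s' -> 1 + cabs (Complex a (e * r)) <= (1 + a) * (1 + s').
    move=> r0 rs; have := ler_cabs (Complex a (e * r)).
    rewrite /= normrM e1 mul1r (ger0_norm r0) (ger0_norm (le_trans ler01 a1)).
    by have := mulr_ge0 (le_trans ler01 a1) s'0; lra.
  apply: le_trans (nrmD _ _ _) _; rewrite !nrmZ !cabs_cexp !ReMr /= -mulrDr.
  have -> : expR (a * t) * (M * (1 + a) ^+ m.*2 + 12 * t * C) * (1 + s') ^+ m.*2 * (s' - s) =
    expR (a * t) * (M * ((1 + a) ^+ m.*2 * (1 + s') ^+ m.*2) * (s' - s)
      + 12 * t * C * ((1 + s') ^+ m.*2 * (s' - s))) by ring.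
  rewrite ler_wpM2l ?expR_ge0 //; apply: lerD.
    apply: le_trans (HM x y (lexx _) (lexx _)) _; rewrite cyx ler_wpM2r ?subr_ge0 //.
    rewrite ler_wpM2l // -exprMn -mul2n exprM lerXn2r ?nnegrE ?exprn_ge0 ?mulr_ge0 ?addr_ge0 ?cabs_ge0 ?a0 //.
    by rewrite expr2; apply: ler_pM; rewrite ?addr_ge0 ?cabs_ge0 // cx.
  (* Two points of the line differ by an imaginary number, so the estimates for nonpositive real
     part apply. *)
  have d0 : complex.Re ((y - x) * t%:C) <= 0 by rewrite yx ReMr /= mul0r.
  apply: (@le_trans _ _ (3 * ((s' - s) * t) * (4 * C))).
    apply: ler_pM; rewrite ?cabs_ge0 ?nrm_ge0 //.
      by apply: le_trans (cabs_cexpB1_le _ d0) _; rewrite cabsM cyx cabs_ger0.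
    apply: le_trans (line_bound x _) _ => //=.
    rewrite ler_piMr ?mulr_ge0 // -(@wt0 R) wt_le //.
  have -> : 3 * ((s' - s) * t) * (4 * C) = 12 * t * C * (1 * (s' - s)) by ring.
  rewrite ler_wpM2l ?mulr_ge0 // ler_wpM2r ?subr_ge0 // exprn_ege1 //; lra.
have [l1 h1] := side 1 (normr1 _); have [l2 h2] := side (-1) (normrN1 _).
suff : exp_lsum t @ \oo --> l1 + l2 by move=> h; rewrite /inv_laplace (cvg_lim _ h).
apply: eq_cvgn (cvgD h1 h2) => n; rewrite fctE /exp_lsum /lsum.
by congr (_ + _); apply: eq_rsum => s _; rewrite ?mul1r ?mulN1r.
Qed.

Lemma nrm_inv_laplace t : 0 <= t -> nrm (inv_laplace t) <= 24 * C * expR (a * t).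
Proof.
move=> t0; apply: nrm_lim_le (exp_lsum_cvg t t0) _ => n.
have -> : 24 * C * expR (a * t) = (expR (a * t) * (4 * C)) * 6 by ring.
apply: lsum_bound => s; rewrite nrmZ cabs_cexp ReMr /= -mulrA ler_wpM2l ?expR_ge0 //.
exact: line_bound.
Qed.

Section Weighted.
Variables (mu : R[i]) (amu : a + 1 <= complex.Re mu).

(** The integrand of the Laplace transform at [mu]. Its kernel [e^((z - mu) t)] is at most [e^(-t)]
    on the line. *)
Definition damped (t : R) : V := cexp (- mu * t%:C) *: inv_laplace t.

Lemma damped_cvg t : 0 <= t ->
  (fun n => lsum n (fun z => cexp ((z - mu) * t%:C) *: F z) a) @ \oo --> damped t.
Proof.
move=> t0; apply: eq_cvgn (cvgZ_nrm _ _ _ (cexp (- mu * t%:C)) (exp_lsum_cvg t t0)) => n.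
rewrite -lsumZ; apply: eq_lsum => z _.
by rewrite scalerA -cexpD -mulrDl [- mu + z]addrC.
Qed.

Lemma Re_line_sub z : complex.Re z = a -> complex.Re (z - mu) <= -1.
Proof. by move=> za; rewrite ReD ReN za; move: amu; lra. Qed.

Lemma sqrt_line_sub z : complex.Re z = a ->
  Num.sqrt (cabs (z - mu)) <= Num.sqrt (a + cabs mu) * Num.sqrt (1 + `|complex.Im z|).
Proof.
move=> za; have m0 := cabs_ge0 mu; have s0 := normr_ge0 (complex.Im z).
rewrite -sqrtrM ?addr_ge0 ?a0 //.
rewrite ler_wsqrtr //; apply: le_trans (cabsD _ _) _; rewrite cabsN.
have := ler_cabs z; rewrite za (ger0_norm a0).
by move: a1; nra.
Qed.

(** Hölder continuity of exponent [1/2]: a Lipschitz estimate of the kernel would cost a full factor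
    [|z - mu|] and leave a majorant of order [|z|^-1], which is not integrable. *)
Lemma damped_diff t t' : 0 <= t' -> t' <= t ->
  nrm (damped t - damped t') <=
    72 * C * Num.sqrt (a + cabs mu) * expR (- t') * Num.sqrt (t - t').
Proof.
move=> t'0 tt'; have t0 : 0 <= t by lra.
apply: nrm_lim_le (cvgB (damped_cvg t t0) (damped_cvg t' t'0)) _ => n.
rewrite fctE -lsumB.
set q := Num.sqrt (a + cabs mu); have q0 : 0 <= q by exact: sqrtr_ge0.
have -> : 72 * C * q * expR (- t') * Num.sqrt (t - t') =
  (3 * q * expR (- t') * Num.sqrt (t - t') * (4 * C)) * 6 by ring.
apply: lsum_bound => s; set z := Complex a s.
have za : complex.Re z = a by []; have wz := Re_line_sub z za; set w := z - mu in wz *.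
have -> : cexp (w * t%:C) *: F z - cexp (w * t'%:C) *: F z =
   cexp (w * t'%:C) *: ((cexp (w * (t - t')%:C) - 1) *: F z).
  by rewrite scalerA mulrBr mulr1 -cexpD -mulrDr -rmorphD /= [t' + _]addrC subrK scalerBl.
rewrite !nrmZ cabs_cexp ReMr.
have d0 : complex.Re (w * (t - t')%:C) <= 0 by rewrite ReMr; nra.
have h1 := cabs_cexpB1_sqrt _ d0; rewrite cabsM cabs_ger0 ?subr_ge0 // sqrtrM ?cabs_ge0 // in h1.
have h2 := sqrt_line_sub z za; have h3 := line_bound_sqrt z za.
rewrite -/w -/q in h2; set r := Num.sqrt (1 + _) in h2 h3.
have r0 : 0 <= r by exact: sqrtr_ge0.
have e1 : expR (complex.Re w * t') <= expR (- t') by rewrite ler_expR; nra.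
have sd0 := sqrtr_ge0 (t - t').
apply: (@le_trans _ _ (expR (- t') * (3 * (q * r * Num.sqrt (t - t')) * nrm (F z)))).
  apply: ler_pM; rewrite ?expR_ge0 ?mulr_ge0 ?cabs_ge0 ?nrm_ge0 //.
  rewrite ler_wpM2r ?nrm_ge0 //; apply: le_trans h1 _.
  by rewrite ler_wpM2l // ler_wpM2r.
have -> : expR (- t') * (3 * (q * r * Num.sqrt (t - t')) * nrm (F z)) =
  3 * q * expR (- t') * Num.sqrt (t - t') * (nrm (F z) * r) by ring.
by rewrite -[X in _ <= X]mulrA ler_wpM2l // !mulr_ge0 ?expR_ge0.
Qed.

Lemma nrm_damped t : 0 <= t -> nrm (damped t) <= 24 * C * expR (- t).
Proof.
move=> t0; rewrite nrmZ cabs_cexp ReMr ReN.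
apply: (@le_trans _ _ (expR (- complex.Re mu * t) * (24 * C * expR (a * t)))).
  by rewrite ler_wpM2l ?expR_ge0 ?nrm_inv_laplace.
by rewrite mulrCA -expRD ler_wpM2l ?mulr_ge0 // ler_expR; move: amu; nra.
Qed.

(** Exchange of the time integral with the line integral: a Riemann sum in time is a finite sum,
    hence a limit of line sums with kernel [time_kernel n (z - mu)], and this kernel is close to
    [(mu - z)^-1] uniformly in the truncation [j] of the line. *)
Lemma rsum_damped_cvg (v : V) :
  (fun n => lsum n (fun z => (mu - z)^-1 *: F z) a) @ \oo --> v ->
  (fun n => rsum n damped) @ \oo --> v.
Proof.
move=> Hv.
set q := Num.sqrt (a + cabs mu); have q0 : 0 <= q by exact: sqrtr_ge0.
pose eta n := 24 * C * (8 * q * Num.sqrt (mesh n) + expR (- n%:R)).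
apply: (@nrm_squeeze _ _ _ _ eta); last first.
  have -> : 0 = 24 * C * (8 * q * 0 + 0) by ring.
  apply: cvgM; first exact: cvg_cst.
  apply: cvgD; last exact: cvgn_expR.
  by apply: cvgM; [exact: cvg_cst|exact: sqrt_mesh_cvg0].
move=> n.
have H1 : (fun j => lsum j (fun z => time_kernel n (z - mu) *: F z) a) @ \oo --> rsum n damped.
  rewrite /rsum /time_kernel; elim: (n * 2 ^ n)%N => [|K IH].
    rewrite big_ord0; apply: eq_cvgn (cvg_cst 0) => j; apply/esym.
    rewrite -[RHS](scale0r (lsum j F a)) -lsumZ.
    by apply: eq_lsum => z _; rewrite big_ord0.
  rewrite big_ord_recr /=.
  apply: eq_cvgn (cvgD IH (cvgZ_nrm _ _ _ (mesh n)%:C (damped_cvg _ (node_ge0 n K)))) => j.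
  rewrite fctE -lsumZ -lsumD; apply: eq_lsum => z _.
  by rewrite big_ord_recr /= scalerDl scalerA.
apply: nrm_lim_le (cvgB H1 Hv) _ => j; rewrite fctE -lsumB.
have -> : eta n = (8 * q * Num.sqrt (mesh n) + expR (- n%:R)) * (4 * C) * 6 by rewrite /eta; ring.
apply: lsum_bound => s; set z := Complex a s.
have za : complex.Re z = a by [].
have h1 := time_kernel_approx n _ (Re_line_sub z za).
rewrite -scalerBl nrmZ.
have -> : time_kernel n (z - mu) - (mu - z)^-1 = time_kernel n (z - mu) + (z - mu)^-1.
  by rewrite -[mu - z]opprB invrN opprK.
have h2 := sqrt_line_sub z za; have h3 := line_bound_sqrt z za.
rewrite -/q in h2; set r := Num.sqrt (1 + _) in h2 h3.
have r1 : 1 <= r by rewrite /r -[X in X <= _]sqrtr1 ler_wsqrtr // lerDl.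
have sm := sqrtr_ge0 (mesh n); have e0 := expR_ge0 (- n%:R : R).
apply: (@le_trans _ _ ((8 * q * Num.sqrt (mesh n) + expR (- n%:R)) * r * nrm (F z))).
  rewrite ler_wpM2r ?nrm_ge0 //; apply: le_trans h1 _; rewrite [X in _ <= X]mulrDl; apply: lerD.
    have -> : 8 * q * Num.sqrt (mesh n) * r = 8 * (Num.sqrt (mesh n) * (q * r)) by ring.
    by rewrite ler_wpM2l // ler_wpM2l.
  by rewrite ler_peMr.
by rewrite -!mulrA [r * _]mulrC ler_wpM2l ?addr_ge0 ?mulr_ge0 // !mulrA.
Qed.

End Weighted.
End Inversion.

(** * From Riemann sums to the Bochner integral *)

Section Bochner.
Context {R : realType}.
Local Notation mesh := (dyadic_mesh R).
Local Notation mu := (@lebesgue_measure R).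

(* Unlike [ge0_le_integral], this requires no measurability. *)
Lemma ge0_subset_integral_le (D : set R) (f : R -> R) (g : R -> \bar R) :
  (forall x, D x -> 0 <= f x) -> (forall x, (0 <= g x)%E) ->
  (forall x, D x -> ((f x)%:E <= g x)%E) ->
  (\int[mu]_(x in D) (f x)%:E <= \int[mu]_x g x)%E.
Proof.
move=> f0 g0 fg; rewrite ge0_integralE; last by move=> x Dx; rewrite lee_fin f0.
rewrite ge0_integralE //; apply: le_ereal_sup => _ [h /= hf <-]; exists h => //= x.
rewrite patchT ?inE //; apply: le_trans (hf x) _.
by rewrite patchE; case: ifPn => // /set_mem; exact: fg.
Qed.

Variables (V : normedModType R[i]) (f : R -> V) (K : R).
Hypothesis fK : forall t, 0 <= t -> nrm (f t) <= K * expR (- t).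
Hypothesis fH : forall t t', 0 <= t' -> t' <= t ->
  nrm (f t - f t') <= K * expR (- t') * Num.sqrt (t - t').

Definition cell (n i : nat) : set R := `[i%:R * mesh n, i.+1%:R * mesh n[%classic.

Definition step_fun n : R -> V :=
  simple_eval (n * 2 ^ n) (cell n) (fun i => f (i%:R * mesh n)).

Lemma cellP n i t : 0 <= t -> cell n i t <-> i = Num.truncn (t / mesh n).
Proof.
move=> t0; have m0 := mesh_gt0 (R := R) n.
have tm0 : 0 <= t / mesh n by rewrite divr_ge0 // ltW.
rewrite /cell /= in_itv /= -ler_pdivlMr // -ltr_pdivrMr //.
split=> [h|->]; [exact/esym/truncn_def|exact: truncn_itv].
Qed.

Lemma step_fun_in n t : 0 <= t -> t < n%:R ->
  step_fun n t = f ((Num.truncn (t / mesh n))%:R * mesh n).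
Proof.
move=> t0 tn; have m0 := mesh_gt0 (R := R) n.
have tm0 : 0 <= t / mesh n by rewrite divr_ge0 // ltW.
have hi : (Num.truncn (t / mesh n) < n * 2 ^ n)%N.
  have /andP[h _] := truncn_itv tm0.
  rewrite -(ltr_nat R); apply: le_lt_trans h _.
  by rewrite ltr_pdivrMr // natrM -mulrA exp2_mesh mulr1.
rewrite /step_fun /simple_eval (bigD1 (Ordinal hi)) //= ifT; last exact/asboolP/cellP.
rewrite big1 ?addr0 // => i ii; rewrite ifF //; apply/asboolP => /(cellP _ _ _ t0) E.
by move/eqP: ii; apply; apply/val_inj.
Qed.

Lemma step_fun_out n t : n%:R <= t -> step_fun n t = 0.
Proof.
move=> nt; have t0 : 0 <= t by exact: le_trans (ler0n _ _) nt.
rewrite /step_fun /simple_eval big1 // => i _; rewrite ifF //; apply/asboolP.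
rewrite /cell /= in_itv /= => /andP[_].
have : i.+1%:R * mesh n <= n%:R.
  have -> : n%:R = (n * 2 ^ n)%:R * mesh n by rewrite natrM -mulrA exp2_mesh mulr1.
  by rewrite ler_wpM2r ?mesh_ge0 // ler_nat.
by move=> h1 h2; have := lt_le_trans h2 h1; rewrite ltNge nt.
Qed.

Let zeta n := K * (expR 1 * Num.sqrt (mesh n) + expR (- n%:R / 2)).

(** Half of the exponential decay is kept as an integrable weight. For [t >= n] the other half gives
    [e^(-n/2)]; for [t < n] the node [t'] below [t] satisfies [t' >= t - 1], whence the factor [e],
    and the Hölder bound gives the square root of the mesh. *)
Lemma step_fun_approx n t : 0 <= t ->
  nrm (f t - step_fun n t) <= zeta n * expR (- (t / 2)).
Proof.
move=> t0; have K0 : 0 <= K.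
  by have := fK 0 (lexx _); rewrite oppr0 expR0 mulr1; apply: le_trans (nrm_ge0 _ _).
rewrite /zeta mulrDr mulrDl; have [tn|nt] := ltP t n%:R; last first.
  rewrite step_fun_out // subr0; apply: le_trans (fK t t0) _.
  rewrite -[X in X <= _]add0r; apply: lerD.
    by rewrite !mulr_ge0 ?expR_ge0 ?sqrtr_ge0.
  by rewrite -mulrA ler_wpM2l // -expRD ler_expR; move: nt; lra.
rewrite step_fun_in //; set t' := _ * mesh n.
have m0 := mesh_gt0 (R := R) n.
have tm0 : 0 <= t / mesh n by rewrite divr_ge0 // ltW.
have /andP[h1 h2] := truncn_itv tm0.
have t't : t' <= t by rewrite /t' -ler_pdivlMr.
have tt' : t <= t' + mesh n.
  by rewrite ltW // /t' -[X in _ + X]mul1r -mulrDl natr1 -ltr_pdivrMr.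
have t'0 : 0 <= t' by exact: node_ge0.
apply: le_trans (fH t t' t'0 t't) _.
rewrite -[X in X <= _]addr0; apply: lerD; last by rewrite !mulr_ge0 ?expR_ge0.
have e1 : expR (- t') <= expR 1 * expR (- (t / 2)).
  by rewrite -expRD ler_expR; have := mesh_le1 (R := R) n; lra.
have s1 : Num.sqrt (t - t') <= Num.sqrt (mesh n) by rewrite ler_wsqrtr //; lra.
rewrite -!mulrA ler_wpM2l // [X in _ <= _ * X]mulrC mulrA.
by apply: ler_pM; rewrite ?expR_ge0 ?sqrtr_ge0.
Qed.

Lemma zeta_cvg0 : zeta @ \oo --> (0 : R).
Proof.
have -> : 0 = K * (expR 1 * 0 + 0) by ring.
apply: cvgM; first exact: cvg_cst.
apply: cvgD; first by apply: cvgM; [exact: cvg_cst|exact: sqrt_mesh_cvg0].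
rewrite (_ : (fun n => _) = fun n => expR (- (1 / 2)) ^+ n); last first.
  by apply/funext => n; rewrite -expRM_natr; congr expR; ring.
by apply: cvg_expr; rewrite ger0_norm ?expR_ge0 // expR_lt1; lra.
Qed.

Lemma bochner_integral_rsum (v : V) :
  (fun n => rsum n f) @ \oo --> v -> bochner_integral `[0, +oo[%classic f v.
Proof.
move=> Hv; split; first exact: measurable_itv.
have D0 t : `[0, +oo[%classic t -> 0 <= t by rewrite /= in_itv /= andbT.
have cellD n i : cell n i `&` `[0, +oo[%classic = cell n i.
  apply/setIidPl => t; rewrite /cell /= !in_itv /= andbT => /andP[h _].
  exact: le_trans (node_ge0 _ _) h.
have mcell n i : mu (cell n i) = (mesh n)%:E.
  rewrite /cell lebesgue_measure_itv /= lte_fin ltr_pM2r ?mesh_gt0 // ltr_nat ltnSn.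
  by rewrite -EFinB -mulrBl -natr1 addrAC subrr add0r mul1r.
exists f, (fun n => n * 2 ^ n)%N, cell, (fun n i => f (i%:R * mesh n)); split.
  exact: aeW.
split; first by move=> n i; split; [exact: measurable_itv|rewrite cellD mcell ltry].
have K0 : 0 <= K.
  by have := fK 0 (lexx _); rewrite oppr0 expR0 mulr1; apply: le_trans (nrm_ge0 _ _).
have z0 n : 0 <= zeta n by rewrite mulr_ge0 // addr_ge0 // ?mulr_ge0 ?expR_ge0 ?sqrtr_ge0.
split.
  move=> t /D0 t0; apply: (@nrm_squeeze _ _ _ _ zeta); last exact: zeta_cvg0.
  move=> n; rewrite nrm_distC; apply: le_trans (step_fun_approx n t t0) _.
  by rewrite ler_piMr // expR_le1; lra.
split; last first.
  (* The integral of the step function is exactly the Riemann sum, as each cell has measure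
     [mesh n]. *)
  apply: eq_cvgn Hv => n; rewrite /rsum /simple_int; apply: eq_bigr => i _.
  by rewrite cellD mcell.
apply: (@squeeze_cvge _ _ _ _ (fun=> 0%E) _ (fun n => (2 * zeta n)%:E)).
- apply: nearW => n; apply/andP; split.
    by apply: integral_ge0 => t _; rewrite lee_fin nrm_ge0.
  (* The exponential density of rate [1/2] is [e^(-t/2) / 2] with total mass [1]; hence the factor
     [2]. *)
  pose g x := ((2 * zeta n)%:E * (exponential_pdf (2^-1 : R) x)%:E)%E.
  have g0 x : (0 <= g x)%E by rewrite mule_ge0 // lee_fin ?mulr_ge0 // exponential_pdf_ge0 // invr_ge0.
  apply: (@le_trans _ _ (\int[mu]_x g x)%E).
    apply: ge0_subset_integral_le => //; first by move=> x _; exact: nrm_ge0.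
    move=> t /D0 t0; rewrite /g -EFinM lee_fin exponential_pdfE //.
    apply: le_trans (step_fun_approx n t t0) _.
    have -> : 2 * zeta n * (2^-1 * expR (- 2^-1 * t)) = zeta n * expR (- 2^-1 * t) by field.
    by rewrite mulNr [2^-1 * t]mulrC.
  rewrite /g ge0_integralZl //.
  + by rewrite integral_exponential_pdf ?mule1 // invr_gt0.
  + by apply/measurable_realfun.measurable_EFinP; exact: measurable_exponential_pdf.
  + by move=> x _; rewrite lee_fin exponential_pdf_ge0 // invr_ge0.
  + by rewrite lee_fin mulr_ge0.
- exact: cvg_cst.
- apply: cvg_EFin; first exact: nearW.
  rewrite -(mulr0 2); apply: cvgM; [exact: cvg_cst|exact: zeta_cvg0].
Qed.

End Bochner.

(** * Resolvents *)

Section Closure.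
Context {R : realType}.
Variables (V : normedModType R[i]).

Lemma closure_nrmP (B : set V) (x : V) :
  closure B x <-> forall e : R, 0 < e -> exists2 y, B y & nrm (x - y) < e.
Proof.
split=> [Bx e e0|H U /nbhs_ballP [e /= e0 He]].
  have e0' : 0 < e%:C by rewrite ltcR.
  have [y [By]] := Bx _ (nbhsx_ballx x _ e0').
  by rewrite -ball_normE /ball_ /= normr_nrm ltcR => h; exists y.
have ee : e = (complex.Re e)%:C by rewrite RRe_real // gtr0_real.
have e0' : 0 < complex.Re e by rewrite -ltcR -ee.
have [y By hy] := H _ e0'; exists y; split => //; apply: He.
by rewrite -ball_normE /ball_ /= normr_nrm ee ltcR.
Qed.

Lemma closure_cvg (B : set V) (f : nat -> V) (l : V) :
  (forall n, closure B (f n)) -> f @ \oo --> l -> closure B l.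
Proof.
move=> Bf /cvg_nrmP /cvgrPdist_lt fl; apply/closure_nrmP => e e0.
have e2 : 0 < e / 2 by lra.
have [N _ /(_ N (leqnn N))] := fl _ e2; rewrite /= sub0r normrN ger0_norm ?nrm_ge0 // => h.
have /closure_nrmP /(_ _ e2) [y By hy] := Bf N; exists y => //.
have := nrmD _ (l - f N) (f N - y); rewrite addrA subrK nrm_distC in h *.
by move: h hy; lra.
Qed.

Lemma closure_linear (B : set V) : (forall c x y, B x -> B y -> B (c *: x + y)) ->
  forall c x y, closure B x -> closure B y -> closure B (c *: x + y).
Proof.
move=> Bl c x y /closure_nrmP Bx /closure_nrmP By; apply/closure_nrmP => e e0.
have c0 := cabs_ge0 c; have c1 : 0 < 1 + cabs c by lra.
have d0 : 0 < e / 2 / (1 + cabs c) by rewrite !divr_gt0.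
have e2 : 0 < e / 2 by lra.
have [x' Bx' hx] := Bx _ d0; have [y' By' hy] := By _ e2.
exists (c *: x' + y'); first exact: Bl.
have -> : c *: x + y - (c *: x' + y') = c *: (x - x') + (y - y').
  by rewrite opprD addrACA scalerBr.
apply: le_lt_trans (nrmD _ _ _) _; rewrite nrmZ.
move: hx; rewrite ltr_pdivlMr // => hx; have := nrm_ge0 _ (x - x'); nra.
Qed.

Lemma closure_stable (B : set V) (T : V -> V) (M : R) :
  (forall x y, T (x - y) = T x - T y) -> op_bound T M -> (forall x, B x -> B (T x)) ->
  forall x, closure B x -> closure B (T x).
Proof.
move=> TB TM BT x /closure_nrmP Bx; apply/closure_nrmP => e e0.
have M1 : 0 < 1 + `|M| by have := normr_ge0 M; lra.
have d0 : 0 < e / (1 + `|M|) by rewrite divr_gt0.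
have [y By hy] := Bx _ d0; exists (T y); first exact: BT.
rewrite -TB; apply: le_lt_trans (TM _) _.
move: hy; rewrite ltr_pdivlMr // => hy; have := nrm_ge0 _ (x - y).
have := ler_norm M; nra.
Qed.

End Closure.

(** * Algebra of the right resolvents of [(E, A)] *)

Section Resolvent.
Context {R : realType} {X Z : normedModType R[i]}.
Variables (E : {linear X -> Z}) (D : set X) (A : X -> Z).

(** For [w = Rm (E u)] one has [(lam E - A) w = E u - (mu - lam) E w]; applying [Rl] gives the
    claim. *)
Lemma resolvent_identity (lam mu : R[i]) (Rl Rm : {linear Z -> X}) :
  is_inverse_of E D A lam Rl -> is_inverse_of E D A mu Rm ->
  forall u, Rm (E u) = Rl (E u) - (mu - lam) *: Rl (E (Rm (E u))).
Proof.
move=> [_ Hl] [Hm _] u; have [Dw Ew] := Hm (E u).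
set w := Rm (E u) in Dw Ew *; rewrite -linearZ -linearB /=.
rewrite -{1}(Hl w Dw); congr (Rl _).
by rewrite -Ew scalerBl opprB [RHS]addrC addrA subrK.
Qed.

Lemma resolvent_unique (lam : R[i]) (Rl Rm : {linear Z -> X}) :
  is_inverse_of E D A lam Rl -> is_inverse_of E D A lam Rm -> forall z, Rl z = Rm z.
Proof.
move=> [_ Hl] [Hm _] z; have [Dw Ew] := Hm z.
by rewrite -[RHS](Hl _ Dw) Ew.
Qed.

(** Apart from the case of equal points, two instances of the resolvent identity are compared and
    [mu - lam] is cancelled. This makes the range of the powers of [R(lam0)] invariant under every
    other resolvent. *)
Lemma resolvent_commute (lam mu : R[i]) (Rl Rm : {linear Z -> X}) :
  is_inverse_of E D A lam Rl -> is_inverse_of E D A mu Rm ->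
  forall u, Rl (E (Rm (E u))) = Rm (E (Rl (E u))).
Proof.
move=> Hl Hm u; have [lm|lm] := eqVneq mu lam.
  rewrite lm in Hm; have U := resolvent_unique lam Rl Rm Hl Hm.
  by rewrite !U.
have ml : mu - lam != 0 by rewrite subr_eq0.
apply: (scalerI ml).
have h1 := resolvent_identity lam mu Rl Rm Hl Hm u.
have h2 := resolvent_identity mu lam Rm Rl Hm Hl u.
have -> : (mu - lam) *: Rl (E (Rm (E u))) = Rl (E u) - Rm (E u).
  by rewrite -[LHS](subKr (Rl (E u))) -h1.
by rewrite {1}h2 addrAC subrr add0r -scaleNr opprB.
Qed.

End Resolvent.

Theorem theorem2p6 (R : realType) (X Z : completeNormedModType R[i])
    (E : {linear X -> Z}) (D : set X) (A : X -> Z) (pres : nat)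
    (lam0 : R[i]) (Rs0 : {linear Z -> X}) :
  (exists M : R, op_bound E M) ->
  closed_densely_defined D A ->
  complex_resolvent_index E D A pres ->
  (* lam0 ∈ ρ(E,A), Rs0 = (lam0 E - A)^{-1} *)
  is_inverse_of E D A lam0 Rs0 -> (exists M : R, op_bound Rs0 M) ->
  let p := pres.+1 in
  (* X_ran = closure of ran (R_r(lam0))^p,  R_r(lam0) = (lam0 E - A)^{-1} E *)
  let Xran := closure (range (iter p (fun x => Rs0 (E x)))) in
  exists (S : R -> X -> X) (omega C : R),
    0 < C /\
    (forall t, 0 <= t ->
       [/\ (forall x, Xran x -> Xran (S t x)),
           (forall (a : R[i]) x y, Xran x -> Xran y ->
              S t (a *: x + y) = a *: S t x + S t y)
         & (forall x, Xran x -> nrm (S t x) <= C * expR (omega * t) * nrm x)]) /\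
    (forall (lam : R[i]) (Rs : {linear Z -> X}),
       is_inverse_of E D A lam Rs -> (exists M : R, op_bound Rs M) ->
       omega < complex.Re lam ->
       forall x0, Xran x0 ->
         exists v : X,
           bochner_integral `[0, +oo[
             (fun t => cexp (- lam * t%:C) *: S t x0) v /\
           Rs (E x0) = lam ^+ p *: v).
Proof.
move=> [ME HE] _ [[om [C1 [C10 Hres]]] _] inv0 _ p Xran.
(* [Rf] is total; outside the half-plane [Rs0] serves as a default value. *)
have /choice [Rf HRf] : forall lam : R[i], exists Rs : {linear Z -> X},
    om < complex.Re lam -> is_inverse_of E D A lam Rs /\
      op_bound Rs (C1 * (complex.Re `|lam|) ^ (pres%:Z - 1)).
  move=> lam; have [h|h] := boolP (om < complex.Re lam); last by exists Rs0.
  by have [Rs HRs] := Hres lam h; exists Rs.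
(* The line lies strictly to the right of [om] and at least [1] away from the pole of [z^-p] at
   [0]. *)
pose a := Num.max om 1 + 1.
have a1 : 1 <= a by rewrite /a lerDr le_max ler01 orbT.
have aom (z : R[i]) : a <= complex.Re z -> om < complex.Re z.
  by apply: lt_le_trans; rewrite /a ltr_pwDr // le_max lexx.
pose T lam x := Rf lam (E x).
pose K := C1 * `|ME|; have K0 : 0 <= K by rewrite mulr_ge0 // ltW.
have z_gt0 (z : R[i]) : a <= complex.Re z -> 0 < cabs z.
  by move=> za; have := ler_Re_cabs z; lra.
(* The exponent [pres - 1] equals [-1] for [pres = 0], so the integer power is rewritten as a
   quotient. *)
have TM (z : R[i]) : a <= complex.Re z -> forall u, nrm (T z u) <= K * (cabs z ^+ pres / cabs z) * nrm u.
  move=> za u; have [_ h] := HRf z (aom z za); apply: le_trans (h _) _.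
  rewrite -/(cabs z) expfzDr ?gt_eqF ?z_gt0 // exprN1.
  have -> : K * (cabs z ^+ pres / cabs z) * nrm u =
      C1 * (cabs z ^+ pres / cabs z) * (`|ME| * nrm u) by rewrite /K; ring.
  rewrite ler_wpM2l ?mulr_ge0 ?invr_ge0 ?exprn_ge0 ?cabs_ge0 // ?(ltW C10) //.
  by apply: le_trans (HE u) _; rewrite ler_wpM2r ?nrm_ge0 ?ler_norm.
have Tinv (z : R[i]) : a <= complex.Re z -> is_inverse_of E D A z (Rf z).
  by move=> /aom /HRf [].
have Tlin (z c : R[i]) u w : T z (c *: u + w) = c *: T z u + T z w.
  by rewrite /T !linearP.
(* With [p = pres + 1] the factor [z^-p] turns the growth [|z|^(pres - 1)] of the resolvent into the
   decay [|z|^-2]. *)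
pose F x (z : R[i]) : X := (z ^+ p)^-1 *: T z x.
have Fs x : smooth a (F x).
  apply: (smoothZ X a (fun z => (z ^+ p)^-1 : R[i]^o) (fun z => T z x)).
    exact: smooth_inv_exp.
  apply: (smooth_resolvent X a T K pres x K0).
  - move=> z za u; apply: le_trans (TM z za u) _; rewrite ler_wpM2r ?nrm_ge0 // ler_wpM2l //.
    have c1 : 1 <= cabs z by have := ler_Re_cabs z; lra.
    have zz := z_gt0 z za.
    rewrite ler_pdivrMr //; apply: le_trans (_ : cabs z ^+ pres * 1 <= _).
      by rewrite mulr1.
    apply: ler_pM; rewrite ?exprn_ge0 ?ler01 ?cabs_ge0 // lerXn2r ?nnegrE ?cabs_ge0 //; lra.
  - by move=> z c u w _; exact: Tlin.
  - by move=> z y u za ya; exact: resolvent_identity (Tinv z za) (Tinv y ya) u.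
have FC x (z : R[i]) : a <= complex.Re z -> nrm (F x z) <= (K * nrm x) / cabs z ^+ 2.
  move=> za; have zz := z_gt0 z za; rewrite nrmZ cabsV cabsX.
  have -> : K * nrm x / cabs z ^+ 2 = (cabs z ^+ p)^-1 * (K * (cabs z ^+ pres / cabs z) * nrm x).
    by rewrite /p (exprS _ pres); field; rewrite expf_neq0 ?gt_eqF.
  by rewrite ler_wpM2l ?invr_ge0 ?exprn_ge0 ?cabs_ge0 // TM.
have Kx (x : X) : 0 <= K * nrm x by rewrite mulr_ge0 ?nrm_ge0.
have [c [c0 Hc]] := lsum_cauchy_kernel a a1.
have ci0 : 0 <= c^-1 by rewrite invr_ge0 ltW.
pose L x := inv_laplace X a (F x).
have Lcvg x t : 0 <= t -> exp_lsum X a (F x) t @ \oo --> L x t.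
  exact: (exp_lsum_cvg X a (K * nrm x) (F x) a1 (Kx x) (Fs x) (FC x)).
(* The rate [a + 1] keeps [lam] at distance at least [1] from the line, as the kernel estimates
   demand. The summand [1] makes the constant positive even when [K = 0]. *)
exists (fun t x => (c^-1)%:C *: L x t), (a + 1), (c^-1 * (24 * K) + 1).
have cK0 : 0 <= c^-1 * (24 * K) by exact: (mulr_ge0 ci0 (mulr_ge0 (ler0n _ 24) K0)).
split; first by lra.
have XranT (z : R[i]) x : a <= complex.Re z -> Xran x -> Xran (T z x).
  move=> za; apply: (closure_stable X _ (T z) (K * (cabs z ^+ pres / cabs z))).
  - by move=> u w; rewrite /T !linearB.
  - exact: TM.
  - move=> _ [u _ <-]; exists (T z u) => //; elim: (p) u => [|k IH] u //=.
    by rewrite IH /T (resolvent_commute E D A z lam0 (Rf z) Rs0 (Tinv z za) inv0).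
have Xlin : forall (b : R[i]) x y, Xran x -> Xran y -> Xran (b *: x + y).
  apply: closure_linear => b _ _ [u _ <-] [w _ <-]; exists (b *: u + w) => //.
  by elim: (p) => [|k IH] //=; rewrite IH !linearP.
have X0 : Xran 0.
  apply: subset_closure; exists 0 => //; elim: (p) => [|k IH] //=.
  by rewrite IH !linear0.
have XZ (b : R[i]) x : Xran x -> Xran (b *: x).
  by move=> hx; rewrite -[_ *: _]addr0; exact: Xlin.
have XD x y : Xran x -> Xran y -> Xran (x + y).
  by move=> hx hy; rewrite -[x]scale1r; exact: Xlin.
have Xrsum n (G : R -> X) : (forall s, 0 <= s -> Xran (G s)) -> Xran (rsum n G).
  move=> HG; rewrite /rsum; elim: (n * 2 ^ n)%N => [|k IH]; first by rewrite big_ord0.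
  by rewrite big_ord_recr /= addrC; apply: Xlin => //; apply: HG; exact: node_ge0.
split.
  move=> t t0; split.
  (* [S t x] is a limit of linear combinations of vectors [R(z) x], all of which lie in the closed
     invariant subspace. *)
  - move=> x Xx; apply/XZ; apply: closure_cvg (Lcvg x t t0) => n.
    by apply: XD; apply: Xrsum => s _; exact/XZ/XZ/XranT.
  - move=> b x y _ _; have -> : L (b *: x + y) t = b *: L x t + L y t; last first.
      by rewrite scalerDr !scalerA mulrC.
    apply: (cvg_unique _ (Lcvg _ t t0)) => //.
    apply: eq_cvgn (cvgD (cvgZ_nrm _ _ _ b (Lcvg x t t0)) (Lcvg y t t0)) => n.
    rewrite fctE -lsumZ -lsumD; apply: eq_lsum => z _.
    by rewrite /F Tlin !scalerDr !scalerA; congr (_ *: _ + _); ring.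
  - move=> x _; rewrite nrmZ cabs_ger0 //.
    have h := nrm_inv_laplace X a (K * nrm x) (F x) a1 (Kx x) (Fs x) (FC x) t t0.
    apply: le_trans (ler_wpM2l ci0 h) _.
    have -> : c^-1 * (24 * (K * nrm x) * expR (a * t)) = c^-1 * (24 * K) * expR (a * t) * nrm x by ring.
    rewrite ler_wpM2r ?nrm_ge0 //; apply: ler_pM; [exact: cK0|exact: expR_ge0|by lra|].
    by rewrite ler_expR ler_wpM2r //; lra.
move=> mu Rs invmu _ amu x _.
have amu' : a + 1 <= complex.Re mu by exact: ltW.
have amu'' : a <= complex.Re mu by lra.
have mu0 : mu != 0 by apply: Re_gt0_neq0; lra.
have RsE : Rs (E x) = T mu x := resolvent_unique E D A mu Rs (Rf mu) invmu (Tinv mu amu'') (E x).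
exists ((mu ^+ p)^-1 *: T mu x); split; last first.
  by rewrite RsE scalerA divff ?scale1r // expf_neq0.
(* By the resolvent identity [(mu - z)^-1 F(z) = z^-p (mu - z)^-1 R(mu) x + R(mu) F(z)]. The scalar
   kernel gives the first limit; the sums of [F] vanish, so the second limit is [R(mu) 0]. *)
have lim1 : (fun n => lsum n (fun z => (mu - z)^-1 *: F x z) a) @ \oo --> (c%:C * (mu ^+ p)^-1) *: T mu x + T mu 0.
  have h1 := cvg_scaler X _ _ (T mu x) (Hc pres mu amu').
  have h2 := cvg_bounded_op X X (T mu) _ _ _ (fun u w => linearB (Rf mu \o E) u w) (TM mu amu'')
    (lsum_cvg0 X a (F x) (K * nrm x) a1 (Fs x) (FC x) (Kx x)).
  apply: eq_cvgn (cvgD h1 h2) => n; rewrite fctE.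
  rewrite -(lsum_linear _ _ _ _ (T mu)) // -(lsum_linear R[i]^o X n a (fun k => k *: T mu x)); last first.
    by move=> k u w; rewrite scalerDl -scalerA.
  rewrite -lsumD; apply: eq_lsum => z za.
  have za' : a <= complex.Re z by rewrite za.
  have muz : mu - z != 0 by apply: Re_gt0_neq0; rewrite ReD ReN za; lra.
  have TFE : T mu (F x z) = (z ^+ p)^-1 *: T mu (T z x) by rewrite /F /T !linearZ.
  have FE : F x z = (z ^+ p)^-1 *: (T mu x + (mu - z) *: T mu (T z x)).
    congr (_ *: _); rewrite {1}/T (resolvent_identity E D A mu z (Rf mu) (Rf z) (Tinv mu amu'') (Tinv z za') x).
    by rewrite -scaleNr opprB.
  rewrite TFE FE.
  rewrite !scalerDr !scalerA; congr (_ *: _ + _ *: _); first exact: mulrC.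
  by rewrite mulrAC mulVf // mul1r.
rewrite {2}/T !linear0 addr0 in lim1.
pose damp := damped X a (F x) mu.
have dE : (fun t => cexp (- mu * t%:C) *: ((c^-1)%:C *: L x t)) = (fun t => (c^-1)%:C *: damp t).
  by apply/funext => t; rewrite !scalerA mulrC.
rewrite dE.
have hd := damped_diff X a (K * nrm x) (F x) a1 (Kx x) (Fs x) (FC x) mu amu'.
have hb := nrm_damped X a (K * nrm x) (F x) a1 (Kx x) (Fs x) (FC x) mu amu'.
have hr := rsum_damped_cvg X a (K * nrm x) (F x) a1 (Kx x) (Fs x) (FC x) mu amu' _ lim1.
have q0 := sqrtr_ge0 (a + cabs mu); set q := Num.sqrt _ in q0 hd.
(* One constant that dominates both the decay bound and the Hölder bound. *)
pose KK := c^-1 * (24 * (K * nrm x) + 72 * (K * nrm x) * q).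
apply: (bochner_integral_rsum X _ KK).
- move=> t t0; rewrite nrmZ cabs_ger0 // /KK -[X in _ <= X]mulrA ler_wpM2l //.
  apply: le_trans (hb t t0) _; rewrite ler_wpM2r ?expR_ge0 // lerDl.
  exact: (mulr_ge0 (mulr_ge0 (ler0n _ 72) (Kx x)) q0).
- move=> t t' t'0 tt'; rewrite -scalerBr nrmZ cabs_ger0 // /KK.
  set es := expR (- t'); set sd := Num.sqrt (t - t').
  have -> : forall r : R, c^-1 * r * es * sd = c^-1 * (r * es * sd) by move=> r; ring.
  rewrite ler_wpM2l //; apply: le_trans (hd t t' t'0 tt') _.
  do 2 (apply: ler_wpM2r; [by rewrite ?expR_ge0 ?sqrtr_ge0|]).
  by rewrite lerDr; exact: (mulr_ge0 (ler0n _ 24) (Kx x)).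
- apply: eq_cvgn (_ : (fun n => (c^-1)%:C *: rsum n damp) @ \oo --> _); first by move=> n; rewrite rsumZ.
  (* The constant [c] of the Cauchy kernel cancels against the normalization of [S]. *)
  have -> : (mu ^+ p)^-1 *: T mu x = (c^-1)%:C *: ((c%:C * (mu ^+ p)^-1) *: T mu x).
    by rewrite scalerA mulrA -rmorphM /= mulVf ?gt_eqF // mul1r.
  exact: cvgZ_nrm.
Qed.
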